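(* Let $k$ be an algebraically closed field, $A$ a finite dimensional $k$-algebra, and $\theta,\theta_1,\ldots,\theta_\ell\in K_0(\operatorname{proj}A)$ with $\theta=\theta_1+\cdots+\theta_\ell$ and $\theta_1\oplus\cdots\oplus\theta_\ell$. (a) For each $\eta\in\operatorname{cone}^\circ\{\theta_1,\ldots,\theta_\ell\}$ we have $\overline{\mathcal{T}}_\eta=\bigcap_{i=1}^\ell\overline{\mathcal{T}}_{\theta_i}$, $\mathcal{T}_\eta=\bigvee_{i=1}^\ell\mathcal{T}_{\theta_i}$, $\overline{\mathcal{F}}_\eta=\bigcap_{i=1}^\ell\overline{\mathcal{F}}_{\theta_i}$, $\mathcal{F}_\eta=\bigvee_{i=1}^\ell\mathcal{F}_{\theta_i}$ and $\mathcal{W}_\eta=\bigcap_{i=1}^\ell\mathcal{W}_{\theta_i}$. (b) $[\theta]_{\rm TF}\supseteq\operatorname{cone}^\circ\{\theta_1,\ldots,\theta_\ell\}$.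
   Context: $\operatorname{mod}A$ is the category of finitely generated right $A$-modules, $\operatorname{proj}A$ its subcategory of projectives, $P(1),\dots,P(n)$ the indecomposable projectives and $S(i)$ the simple top of $P(i)$. $K_0(\operatorname{proj}A)$ is free with basis $[P(i)]$ and $K_0(\operatorname{proj}A)_\mathbb{R}:=K_0(\operatorname{proj}A)\otimes_\mathbb{Z}\mathbb{R}$. Each $\theta\in K_0(\operatorname{proj}A)_\mathbb{R}$ gives a linear form $X\mapsto\theta(X)$ on modules via the pairing $\langle [P(i)],[S(j)]\rangle=\delta_{ij}$. Semistable torsion classes: $\mathcal{T}_\theta=\{X\mid \theta(X')>0$ for all nonzero factor modules $X'$ of $X\}$, $\overline{\mathcal{T}}_\theta=\{X\mid\theta(X')\ge0$ for all factor modules $X'\}$, $\mathcal{F}_\theta=\{X\mid\theta(X')<0$ for all nonzero submodules $X'\}$, $\overline{\mathcal{F}}_\theta=\{X\mid\theta(X')\le 0$ for all submodules $X'\}$, $\mathcal{W}_\theta=\overline{\mathcal{T}}_\theta\cap\overline{\mathcal{F}}_\theta$. $\theta,\eta$ are TF equivalent if $\overline{\mathcal{T}}_\theta=\overline{\mathcal{T}}_\eta$ and $\overline{\mathcal{F}}_\theta=\overline{\mathcal{F}}_\eta$; $[\theta]_{\rm TF}$ denotes the class of $\theta$. $\vee$ denotes the join (smallest torsion, resp. torsion-free, class containing the union). $\operatorname{cone}^\circ X=\sum_{x\in X}\mathbb{R}_{>0}x$. For $\theta\in K_0(\operatorname{proj}A)$ write uniquely $\theta=[P_0^\theta]-[P_1^\theta]$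 with $P_0^\theta,P_1^\theta$ having no common nonzero direct summand; $\operatorname{Hom}(\theta):=\operatorname{Hom}_A(P_1^\theta,P_0^\theta)$ (an irreducible affine variety, Zariski topology; ''general'' means in a nonempty open dense subset). For a morphism $f\colon P_1\to P_0$ in $\operatorname{proj}A$, $P_f$ is the 2-term complex $(P_1\xrightarrow{f}P_0)$ in degrees $-1,0$ of $\mathsf{K}^b(\operatorname{proj}A)$. We write $\theta_1\oplus\cdots\oplus\theta_\ell$ if for general $f\in\operatorname{Hom}(\theta_1+\cdots+\theta_\ell)$ there exist $f_i\in\operatorname{Hom}(\theta_i)$ with $P_f\cong P_{f_1}\oplus\cdots\oplus P_{f_\ell}$. *)

(* Defs.v *)
From HB Require Import structures.
From mathcomp Require Import all_boot all_order all_algebra.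
From mathcomp Require Import falgebra.
From mathcomp Require Import reals.
Set Implicit Arguments. Unset Strict Implicit. Unset Printing Implicit Defensive.
Import Order.TTheory GRing.Theory Num.Theory.
Local Open Scope ring_scope.

(* Conventions:
   - k : algebraically closed field, A : finite dimensional k-algebra (falgType k).
   - e : 'I_n -> A is a complete set of pairwise non-isomorphic primitive
     idempotents, so P(i) := e i A are the indecomposable projectives (up to iso).
   - A finitely generated right A-module is a finite dimensional k-vector space
     k^d (row vectors) with a right action  v . a := v *m fact a.
   - theta(X) = sum_i theta_i [X : S(i)] = sum_i theta_i dim_k (X e_i)
              = sum_i theta_i \rank (fact X (e i)).                          *)

Section Defs.
Variable k : closedFieldType.
Variable A : falgType k.
Variable n : nat.
Variable e : 'I_n -> A.

Definition idem (f : A) := f * f = f.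
Definition primitive_idem (f : A) :=
  idem f /\ f != 0 /\
  forall g : A, idem g -> f * g = g -> g * f = g -> g = 0 \/ g = f.
(* fA ~= gA as right A-modules:  Hom(fA,gA) = gAf, Hom(gA,fA) = fAg *)
Definition iso_idem (f g : A) :=
  exists x y : A, x = g * x * f /\ y = f * y * g /\ y * x = f /\ x * y = g.
Definition complete_prim_idems :=
  (forall i, primitive_idem (e i)) /\
  (forall i j, iso_idem (e i) (e j) -> i = j) /\
  (forall f, primitive_idem f -> exists i, iso_idem f (e i)).

Record fmod := FMod {
  fdim : nat;
  fact : A -> 'M[k]_fdim;
  fact_mul : forall a b, fact (a * b) = fact a *m fact b;
  fact_one : fact 1 = 1%:M;
  fact_lin : forall (c : k) a b, fact (c *: a + b) = c *: fact a + fact b }.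

Definition mhom (X Y : fmod) (M : 'M[k]_(fdim X, fdim Y)) :=
  forall a, fact X a *m M = M *m fact Y a.
Definition factor_of (X Y : fmod) :=
  exists M : 'M[k]_(fdim X, fdim Y), mhom M /\ row_full M.
Definition submod_of (X Y : fmod) :=
  exists M : 'M[k]_(fdim Y, fdim X), mhom M /\ row_free M.
Definition ses (X Y Z : fmod) :=
  exists (f : 'M[k]_(fdim X, fdim Y)) (g : 'M[k]_(fdim Y, fdim Z)),
    mhom f /\ mhom g /\ row_free f /\ row_full g /\ f *m g = 0 /\
    fdim Y = (fdim X + fdim Z)%N.

Definition mclass := fmod -> Prop.
Definition eqclass (C D : mclass) := forall X, C X <-> D X.

Definition torsion_class (C : mclass) :=
  (forall X, fdim X = 0%N -> C X) /\
  (forall X Y, C X -> factor_of X Y -> C Y) /\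
  (forall X Y Z, ses X Y Z -> C X -> C Z -> C Y).
Definition torsionfree_class (C : mclass) :=
  (forall X, fdim X = 0%N -> C X) /\
  (forall X Y, C X -> submod_of X Y -> C Y) /\
  (forall X Y Z, ses X Y Z -> C X -> C Z -> C Y).

Definition tjoin (l : nat) (D : 'I_l -> mclass) : mclass := fun X =>
  forall C, torsion_class C -> (forall i Y, D i Y -> C Y) -> C X.
Definition fjoin (l : nat) (D : 'I_l -> mclass) : mclass := fun X =>
  forall C, torsionfree_class C -> (forall i Y, D i Y -> C Y) -> C X.
Definition bigcap (l : nat) (D : 'I_l -> mclass) : mclass := fun X =>
  forall i, D i X.

Section Real.
Variable R : realType.

(* theta(X) for theta in K_0(proj A)_R = R^n (basis [P(i)]) *)
Definition evK (th : 'I_n -> R) (X : fmod) : R :=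
  \sum_(i < n) th i * (\rank (fact X (e i)))%:R.

Definition Tbar th : mclass := fun X =>
  forall Y, factor_of X Y -> 0 <= evK th Y.
Definition Tss th : mclass := fun X =>
  forall Y, factor_of X Y -> (0 < fdim Y)%N -> 0 < evK th Y.
Definition Fbar th : mclass := fun X =>
  forall Y, submod_of X Y -> evK th Y <= 0.
Definition Fss th : mclass := fun X =>
  forall Y, submod_of X Y -> (0 < fdim Y)%N -> evK th Y < 0.
Definition Wss th : mclass := fun X => Tbar th X /\ Fbar th X.

Definition TF_equiv (th et : 'I_n -> R) :=
  eqclass (Tbar th) (Tbar et) /\ eqclass (Fbar th) (Fbar et).

Definition toR (th : 'I_n -> int) : 'I_n -> R := fun i => (th i)%:~R.

Definition in_open_cone (l : nat) (th : 'I_l -> 'I_n -> int) (eta : 'I_n -> R) :=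
  exists c : 'I_l -> R, (forall i, 0 < c i) /\
    forall j, eta j = \sum_(i < l) c i * (th i j)%:~R.
End Real.

(* An object s : seq 'I_n stands for  (+)_a e_(s_a) A  (column vectors);
   a morphism s -> t is a matrix M : 'M[A]_(size t, size s) with
   M a b in e_(t_a) A e_(s_b), acting by left multiplication;
   composition is matrix product.                                         *)
Definition oidx (s : seq 'I_n) (a : 'I_(size s)) : 'I_n := tnth (in_tuple s) a.
Definition wf (s t : seq 'I_n) (M : 'M[A]_(size t, size s)) :=
  forall a b, M a b = e (oidx a) * M a b * e (oidx b).
Definition idm (s : seq 'I_n) : 'M[A]_(size s) :=
  \matrix_(a, b) (if a == b then e (oidx a) else 0).

(* P^theta_0 and P^theta_1 : no common direct summand *)
Definition pospart (z : int) : nat := if (0 <= z)%R then `|z|%N else 0%N.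
Definition negpart (z : int) : nat := pospart (- z).
Definition P0 (th : 'I_n -> int) : seq 'I_n :=
  flatten [seq nseq (pospart (th i)) i | i <- enum 'I_n].
Definition P1 (th : 'I_n -> int) : seq 'I_n :=
  flatten [seq nseq (negpart (th i)) i | i <- enum 'I_n].
(* Hom(theta) = { f in 'M[A]_(size (P0 th), size (P1 th)) | wf f } *)

(* 2-term complexes  c1 --d--> c0  (degrees -1, 0) *)
Record cplx := Cplx { c1 : seq 'I_n; c0 : seq 'I_n; cd : 'M[A]_(size c0, size c1) }.

Definition is_chain (P Q : cplx) (u1 : 'M[A]_(size (c1 Q), size (c1 P)))
    (u0 : 'M[A]_(size (c0 Q), size (c0 P))) :=
  wf u1 /\ wf u0 /\ u0 *m cd P = cd Q *m u1.
Definition homotopic (P Q : cplx)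
    (a1 b1 : 'M[A]_(size (c1 Q), size (c1 P)))
    (a0 b0 : 'M[A]_(size (c0 Q), size (c0 P))) :=
  exists h : 'M[A]_(size (c1 Q), size (c0 P)),
    wf h /\ a0 - b0 = cd Q *m h /\ a1 - b1 = h *m cd P.

(* P is isomorphic in K^b(proj A) to the direct sum of the Q j, i.e. P is a
   biproduct of the Q j in the homotopy category. *)
Definition is_dsum (P : cplx) (l : nat) (Q : 'I_l -> cplx) :=
  exists (i1 : forall j, 'M[A]_(size (c1 P), size (c1 (Q j))))
         (i0 : forall j, 'M[A]_(size (c0 P), size (c0 (Q j))))
         (p1 : forall j, 'M[A]_(size (c1 (Q j)), size (c1 P)))
         (p0 : forall j, 'M[A]_(size (c0 (Q j)), size (c0 P))),
    (forall j, is_chain (i1 j) (i0 j)) /\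
    (forall j, is_chain (p1 j) (p0 j)) /\
    (forall j, homotopic (p1 j *m i1 j) (idm _) (p0 j *m i0 j) (idm _)) /\
    (forall j j', j != j' ->
        homotopic (Q := Q j) (p1 j *m i1 j') 0 (p0 j *m i0 j') 0) /\
    homotopic (\sum_j i1 j *m p1 j) (idm _) (\sum_j i0 j *m p0 j) (idm _).

Definition kscale (r c : nat) (x : k) (M : 'M[A]_(r, c)) : 'M[A]_(r, c) :=
  map_mx (fun a => x *: a) M.
Definition klinear (r c : nat) (phi : 'M[A]_(r, c) -> k) :=
  (forall M N, phi (M + N) = phi M + phi N) /\
  (forall x M, phi (kscale x M) = x * phi M).
Inductive polyfun (r c : nat) : ('M[A]_(r, c) -> k) -> Prop :=
| pf_lin phi : klinear phi -> polyfun phi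
| pf_cst (x : k) : polyfun (fun _ => x)
| pf_add p q : polyfun p -> polyfun q -> polyfun (fun M => p M + q M)
| pf_mul p q : polyfun p -> polyfun q -> polyfun (fun M => p M * q M).

(* "a general f in Hom_A(P_s, P_t) satisfies Prop": Prop holds on a nonempty
   Zariski open (hence dense) subset of the affine space Hom_A(P_s, P_t);
   equivalently on a nonempty basic open set. *)
Definition general (s t : seq 'I_n) (Pr : 'M[A]_(size t, size s) -> Prop) :=
  exists p : 'M[A]_(size t, size s) -> k, polyfun p /\
    (exists M, wf M /\ p M != 0) /\
    (forall M, wf M -> p M != 0 -> Pr M).

Definition dsum_decomp (l : nat) (th : 'I_l -> 'I_n -> int) :=
  general (s := P1 (fun j => \sum_(i < l) th i j)) (t := P0 (fun j => \sum_(i < l) th i j))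
    (fun f => exists fs : forall i, 'M[A]_(size (P0 (th i)), size (P1 (th i))),
       (forall i, wf (fs i)) /\
       is_dsum (Cplx f) (fun i => Cplx (fs i))).
End Defs.

(* Main.v *)
Require Import Defs.
From HB Require Import structures.
From mathcomp Require Import all_boot all_order all_algebra.
From mathcomp Require Import falgebra.
From mathcomp Require Import boolp reals.
Import Order.TTheory GRing.Theory Num.Theory.
Import VectorInternalTheory.
Local Open Scope ring_scope.
Set Implicit Arguments. Unset Strict Implicit. Unset Printing Implicit Defensive.

(* Choose a general f in Hom(theta) for which the tangent map
   (u, v) |-> f u + v f of the orbit has maximal rank.  If some class in
   Hom(P_(f_i), P_(f_j)[1]) with i <> j were nonzero, it would give a direction xi
   along which the rank jumps, because the idempotent of P_f projecting onto
   P_(f_i) is a kernel vector of the tangent map that the derivative in the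
   direction xi sends to xi, outside the image.  Hence
   Hom(P_(f_i), P_(f_j)[1]) = 0 for all i <> j.

   Let Z be a module in F_(theta_i).  Each nonzero submodule N of Z has
   theta_i(N) < 0, so Hom(P_(f_i), N[1]) <> 0, and a nonzero functional on it
   defines a nonzero factor module of N which, by the vanishing above, lies in the
   torsion-free class { Y | Hom(P_(f_j), Y) = 0 }.  So Z is filtered by such
   modules, Hom(P_(f_j), Z) = 0 and theta_j(Z) <= 0.  Dually theta_j >= 0 on
   T_(theta_i).  A module X outside the semistable class of theta_i has a nonzero
   factor module Z in F_(theta_i), and then eta(Z) < 0 for all eta in the open
   cone, so X is not in the semistable class of eta.  The joins follow from the
   torsion pairs. *)

(** * Maximal choices and subspaces described by predicates *)

Lemma ex_max_nat (P : nat -> Prop) (N : nat) :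
  (exists m, P m) -> (forall m, P m -> (m <= N)%N) ->
  exists2 m, P m & forall m', P m' -> (m' <= m)%N.
Proof.
move=> exP ubP.
have exP' : exists m, `[< P m >] by case: exP => m Pm; exists m; apply/asboolP.
have ubP' m : `[< P m >] -> (m <= N)%N by move=> /asboolP; apply: ubP.
case: (ex_maxnP exP' ubP') => m /asboolP Pm maxm.
by exists m => // m' Pm'; apply/maxm/asboolP.
Qed.

(** Take [W] of maximal rank with row space inside [P]; adjoining a vector of [P] stays inside [P],
    so the rank cannot grow. *)
Lemma rowspace_pred (F : fieldType) (d : nat) (P : 'rV[F]_d -> Prop) :
  P 0 -> (forall a u v, P u -> P v -> P (a *: u + v)) ->
  exists W : 'M[F]_d, forall v, (v <= W)%MS <-> P v.
Proof.
move=> P0 Plin.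
pose Q r := exists W : 'M[F]_d, (forall v, (v <= W)%MS -> P v) /\ \rank W = r.
have [||r [W [WP rW]] rmax] := @ex_max_nat Q d.
- exists 0%N, 0; split; last by rewrite mxrank0.
  by move=> v; rewrite submx0 => /eqP->.
- by move=> m [W [_ <-]]; apply: rank_leq_row.
exists W => v; split; [exact: WP | move=> Pv].
have QWv : Q (\rank (W + v)%MS).
  exists (W + v)%MS; split=> // u /sub_addsmxP[[w c] /= ->].
  rewrite addrC (mx11_scalar c) mul_scalar_mx; apply: Plin => //.
  by apply: WP; apply: submxMl.
have := rmax _ QWv; rewrite -rW => le_r.
apply: submx_trans (addsmxSr W v) _.
by rewrite -(geq_leqif (mxrank_leqif_sup (addsmxSl W v))).
Qed.

(** * Null-homotopic morphisms and the choice of a general [f] *)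

Section Complexes.
Variables (k : closedFieldType) (A : falgType k) (n : nat) (e : 'I_n -> A).
Hypothesis eK : forall i, e i * e i = e i.

Section Coordinates.
Variables r c : nat.
Implicit Types M N : 'M[A]_(r, c).

(** Flattens a matrix over [A] to a row vector over [k], which makes rank arguments over [k]
    available for Hom spaces. *)
Definition coords M := v2r ([ffun p => M p.1 p.2] : {ffun 'I_r * 'I_c -> A}).

Lemma coordsD : {morph coords : M N / M + N}.
Proof.
by move=> M N; rewrite -linearD; congr v2r; apply/ffunP=> p; rewrite !ffunE mxE.
Qed.

Lemma coordsZ x M : coords (kscale x M) = x *: coords M.
Proof. by rewrite -linearZ; congr v2r; apply/ffunP=> p; rewrite !ffunE mxE. Qed.

Lemma coords0 : coords 0 = 0.
Proof. by rewrite -(linear0 v2r); congr v2r; apply/ffunP=> p; rewrite !ffunE mxE. Qed.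

Lemma coords_inj : injective coords.
Proof.
move=> M N /(can_inj v2rK)/ffunP eqMN; apply/matrixP=> a b.
by have := eqMN (a, b); rewrite !ffunE.
Qed.

Lemma coords_sum (I : Type) (s : seq I) (F : I -> 'M[A]_(r, c)) :
  coords (\sum_(i <- s) F i) = \sum_(i <- s) coords (F i).
Proof. exact: (big_morph coords coordsD coords0). Qed.

Lemma klinear0 (phi : 'M[A]_(r, c) -> k) : klinear phi -> phi 0 = 0.
Proof. by case=> phiD _; apply: (addrI (phi 0)); rewrite -phiD !addr0. Qed.

Lemma klinear_sum (phi : 'M[A]_(r, c) -> k) (I : Type) (s : seq I) F :
  klinear phi -> phi (\sum_(i <- s) F i) = \sum_(i <- s) phi (F i).
Proof. by move=> lphi; apply: (big_morph phi lphi.1 (klinear0 lphi)). Qed.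

(** The functional is a coordinate of the cokernel of the row space of [S], chosen nonzero at
    [xi]. *)
Lemma klinear_separation (S : 'M[A]_(r, c) -> Prop) (xi : 'M[A]_(r, c)) :
  S 0 -> (forall M N, S M -> S N -> S (M + N)) ->
  (forall x M, S M -> S (kscale x M)) -> ~ S xi ->
  exists phi, [/\ klinear phi, forall M, S M -> phi M = 0 & phi xi != 0].
Proof.
move=> S0 SD SZ nSxi.
pose P v := exists2 M, S M & coords M = v.
have [||W WP] := @rowspace_pred _ _ P.
- by exists 0; [| exact: coords0].
- move=> a _ _ [M SM <-] [N SN <-]; exists (kscale a M + N).
    by apply: SD => //; apply: SZ.
  by rewrite coordsD coordsZ.
have /rV0Pn[j nzj] : coords xi *m cokermx W != 0.
  rewrite -submxE; apply/negP=> /WP[M SM] /coords_inj eqM.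
  by apply: nSxi; rewrite -eqM.
exists (fun M => (coords M *m cokermx W) 0 j); split=> //.
  split=> [M N|x M]; first by rewrite coordsD mulmxDl mxE.
  by rewrite coordsZ -scalemxAl mxE.
move=> M SM; have : (coords M <= W)%MS by apply/WP; exists M.
by rewrite submxE => /eqP->; rewrite mxE.
Qed.

Lemma polyfun_line (p : 'M[A]_(r, c) -> k) M N : polyfun p ->
  exists q : {poly k}, forall t, p (M + kscale t N) = q.[t].
Proof.
elim=> [phi [phiD phiZ]|x|p1 p2 _ [q1 Hq1] _ [q2 Hq2]|p1 p2 _ [q1 Hq1] _ [q2 Hq2]].
- exists ((phi M)%:P + (phi N)%:P * 'X) => t.
  by rewrite phiD phiZ !hornerE mulrC.
- by exists x%:P => t; rewrite hornerC.
- by exists (q1 + q2) => t; rewrite hornerD Hq1 Hq2.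
- by exists (q1 * q2) => t; rewrite hornerM Hq1 Hq2.
Qed.

End Coordinates.

Lemma kscale_mull (a b c : nat) x (M : 'M[A]_(a, b)) (N : 'M[A]_(b, c)) :
  kscale x (M *m N) = kscale x M *m N.
Proof.
apply/matrixP=> i j; rewrite !mxE scaler_sumr.
by apply: eq_bigr => h _; rewrite !mxE scalerAl.
Qed.

Lemma kscale_mulr (a b c : nat) x (M : 'M[A]_(a, b)) (N : 'M[A]_(b, c)) :
  kscale x (M *m N) = M *m kscale x N.
Proof.
apply/matrixP=> i j; rewrite !mxE scaler_sumr.
by apply: eq_bigr => h _; rewrite !mxE scalerAr.
Qed.

Lemma kscaleD (a b : nat) x (M N : 'M[A]_(a, b)) :
  kscale x (M + N) = kscale x M + kscale x N.
Proof. by apply/matrixP=> i j; rewrite !mxE scalerDr. Qed.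

Lemma kscale0r (a b : nat) (M : 'M[A]_(a, b)) : kscale 0 M = 0.
Proof. by apply/matrixP=> i j; rewrite !mxE scale0r. Qed.

Lemma idm_mull (s t : seq 'I_n) (M : 'M[A]_(size t, size s)) a b :
  (idm e t *m M) a b = e (oidx a) * M a b.
Proof.
rewrite mxE (bigD1 a) //= mxE eqxx big1 ?addr0 // => c ca.
by rewrite mxE eq_sym (negbTE ca) mul0r.
Qed.

Lemma idm_mulr (s t : seq 'I_n) (M : 'M[A]_(size t, size s)) a b :
  (M *m idm e s) a b = M a b * e (oidx b).
Proof.
rewrite mxE (bigD1 b) //= mxE eqxx big1 ?addr0 // => c cb.
by rewrite mxE (negbTE cb) mulr0.
Qed.

Lemma wfP (s t : seq 'I_n) (M : 'M[A]_(size t, size s)) :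
  wf e M <-> idm e t *m M *m idm e s = M.
Proof.
split=> [wfM|eqM a b]; last by rewrite -{1}eqM idm_mulr idm_mull.
by apply/matrixP=> a b; rewrite idm_mulr idm_mull -wfM.
Qed.

Lemma idmK (s : seq 'I_n) : idm e s *m idm e s = idm e s.
Proof.
apply/matrixP=> a b; rewrite idm_mull !mxE.
by case: eqP => _; rewrite ?mulr0 ?eK.
Qed.

Lemma wf_idml (s t : seq 'I_n) (M : 'M[A]_(size t, size s)) :
  wf e M -> idm e t *m M = M.
Proof. by move=> /wfP <-; rewrite !mulmxA idmK. Qed.

Lemma wf_idmr (s t : seq 'I_n) (M : 'M[A]_(size t, size s)) :
  wf e M -> M *m idm e s = M.
Proof. by move=> /wfP <-; rewrite -!mulmxA idmK. Qed.

Lemma wf_mul (s t w : seq 'I_n) (M : 'M[A]_(size t, size s))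
    (N : 'M[A]_(size s, size w)) : wf e M -> wf e N -> wf e (M *m N).
Proof.
by move=> wM wN; apply/wfP; rewrite mulmxA wf_idml // -mulmxA wf_idmr.
Qed.

Lemma wf_add (s t : seq 'I_n) (M N : 'M[A]_(size t, size s)) :
  wf e M -> wf e N -> wf e (M + N).
Proof. by move=> wM wN a b; rewrite mxE mulrDr mulrDl -wM -wN. Qed.

Lemma wf_opp (s t : seq 'I_n) (M : 'M[A]_(size t, size s)) :
  wf e M -> wf e (- M).
Proof. by move=> wM a b; rewrite mxE mulrN mulNr -wM. Qed.

Lemma wf_kscale (s t : seq 'I_n) x (M : 'M[A]_(size t, size s)) :
  wf e M -> wf e (kscale x M).
Proof. by move=> wM a b; rewrite mxE -scalerAr -scalerAl -wM. Qed.

Lemma wf_0 (s t : seq 'I_n) : wf e (0 : 'M[A]_(size t, size s)).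
Proof. by move=> a b; rewrite mxE mulr0 mul0r. Qed.

(* [X : P_1 -> P_0'] represents the zero class in Hom(P_g, P_f[1]), where
   [g : P_1 -> P_0] and [f : P_1' -> P_0']. *)
Definition null_shift (s t s' t' : seq 'I_n) (f : 'M[A]_(size t', size s'))
    (g : 'M[A]_(size t, size s)) (X : 'M[A]_(size t', size s)) :=
  exists (u : 'M[A]_(size s', size s)) (v : 'M[A]_(size t', size t)),
    [/\ wf e u, wf e v & X = f *m u + v *m g].

Section NullShift.
Variables (s t s' t' : seq 'I_n) (f : 'M[A]_(size t', size s')).
Variable (g : 'M[A]_(size t, size s)).

Lemma null_shift0 : null_shift f g 0.
Proof. by exists 0, 0; split; rewrite ?mulmx0 ?mul0mx ?addr0 //; apply: wf_0. Qed.

Lemma null_shiftD X Y : null_shift f g X -> null_shift f g Y ->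
  null_shift f g (X + Y).
Proof.
move=> [u [v [wu wv ->]]] [u' [v' [wu' wv' ->]]]; exists (u + u'), (v + v').
by split; [exact: wf_add | exact: wf_add | rewrite mulmxDr mulmxDl addrACA].
Qed.

Lemma null_shiftZ x X : null_shift f g X -> null_shift f g (kscale x X).
Proof.
move=> [u [v [wu wv ->]]]; exists (kscale x u), (kscale x v).
by split; [exact: wf_kscale | exact: wf_kscale | rewrite kscaleD kscale_mulr kscale_mull].
Qed.

Lemma null_shift_l u : wf e u -> null_shift f g (f *m u).
Proof. by move=> wu; exists u, 0; split; rewrite ?mul0mx ?addr0 //; apply: wf_0. Qed.

Lemma null_shift_r v : wf e v -> null_shift f g (v *m g).
Proof. by move=> wv; exists 0, v; split; rewrite ?mulmx0 ?add0r //; apply: wf_0. Qed.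

End NullShift.
End Complexes.

(** * Perturbing a general morphism: vanishing of Hom between distinct summands *)

Section GeneralMorphism.
Variables (k : closedFieldType) (A : falgType k) (n : nat) (e : 'I_n -> A).
Hypothesis eK : forall i, e i * e i = e i.

Section Perturbation.
Variables s t : seq 'I_n.
Let H := 'M[A]_(size t, size s).
Let endos := ('M[A]_(size s) * 'M[A]_(size t))%type.

(** Differential at the identity of the action of pairs of automorphisms; on well-formed pairs its
    image is exactly [null_shift e f f]. *)
Definition tangent (f : H) (w : endos) : H := f *m w.1 + w.2 *m f.

(* Rank at least [m], witnessed by a nonzero [m]-minor, so that it is visibly an
   open condition on [f]. *)
Definition tangent_rank_ge (f : H) (m : nat) :=
  exists (w : 'I_m -> endos) (phi : 'I_m -> H -> k),
    [/\ forall i, wf e (w i).1 /\ wf e (w i).2, forall i, klinear (phi i)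
      & \det (\matrix_(i, j) phi j (tangent f (w i))) != 0].

(** More tangent vectors than the dimension of the ambient matrix space are linearly dependent,
    which kills the minor. Hence a maximal rank exists. *)
Lemma tangent_rank_bound f m : tangent_rank_ge f m ->
  (m <= dim {ffun 'I_(size t) * 'I_(size s) -> A})%N.
Proof.
move=> [w [phi [_ lphi nz]]]; rewrite leqNgt; apply/negP=> lt_m.
pose V := \matrix_(j < m) coords (tangent f (w j)).
have : kermx V != 0.
  by rewrite -mxrank_eq0 mxrank_ker subn_eq0 -ltnNge (leq_ltn_trans (rank_leq_col _)).
case/rowV0Pn=> c /sub_kermxP cV nz_c.
have lin_dep : \sum_i kscale (c 0 i) (tangent f (w i)) = 0.
  apply: coords_inj; rewrite coords_sum coords0 -[RHS]cV mulmx_sum_row.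
  by apply: eq_bigr => j _; rewrite coordsZ rowK.
move/negP: nz; apply; apply/det0P; exists c => //; apply/rowP=> j; rewrite !mxE.
rewrite -[RHS](klinear0 (lphi j)) -lin_dep klinear_sum //.
by apply: eq_bigr => i _; rewrite (lphi j).2 mxE.
Qed.

(* First-order perturbation: a kernel vector [w] of the tangent map of [f] whose
   derivative in the direction [xi] leaves the image makes the rank jump. *)
Lemma tangent_rank_jump f xi (w : endos) m (p : H -> k) :
  polyfun p -> p f != 0 -> tangent_rank_ge f m ->
  wf e w.1 -> wf e w.2 -> tangent f w = 0 ->
  ~ null_shift e f f (tangent xi w) ->
  exists x, p (f + kscale x xi) != 0 /\ tangent_rank_ge (f + kscale x xi) m.+1.
Proof.
move=> pp pf0 [ws [phi [wf_ws lphi nz]]] w1 w2 fw0 nS.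
(* [psi] kills the tangent image at [f] but not the derivative along [xi] at [w]; [w] and [psi]
   become row and column 0 of the enlarged minor. *)
have [psi [lpsi psi0 psi_xi]] := klinear_separation (null_shift0 e f f)
  (@null_shiftD _ _ _ e _ _ _ _ f f) (@null_shiftZ _ _ _ e _ _ _ _ f f) nS.
have [q Hq] := polyfun_line f xi pp.
pose W (i : 'I_m.+1) := oapp ws w (unlift ord0 i).
pose Phi (j : 'I_m.+1) := oapp phi psi (unlift ord0 j).
have lPhi j : klinear (Phi j).
  by rewrite /Phi; case: unliftP => [i _|_] /=; [exact: lphi | exact: lpsi].
have tangentD x v : tangent (f + kscale x xi) v = tangent f v + kscale x (tangent xi v).
  by rewrite /tangent mulmxDl mulmxDr kscaleD kscale_mull kscale_mulr addrACA.
(* The minor at [f + x xi], with its row of [w] divided by [x]. *)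
pose Q : 'M[{poly k}]_m.+1 := \matrix_(i, j)
  if i == ord0 then (Phi j (tangent xi w))%:P
  else (Phi j (tangent f (W i)))%:P + (Phi j (tangent xi (W i)))%:P * 'X.
have Qx x : \det (\matrix_(i, j) Phi j (tangent (f + kscale x xi) (W i))) = x * (\det Q).[x].
  pose D : 'rV[k]_m.+1 := \row_i (if i == ord0 then x else 1).
  have detD : \det (diag_mx D) = x.
    rewrite det_diag big_ord_recl big1 ?mxE ?mulr1 // => i _.
    by rewrite mxE.
  transitivity (\det (diag_mx D) * horner_eval x (\det Q)); last by rewrite detD.
  rewrite -det_map_mx -det_mulmx; congr (\det _).
  apply/matrixP=> i j; rewrite mul_diag_mx !mxE /= /horner_eval.
  case: eqP => [->|_].
    by rewrite {1}/W unlift_none tangentD fw0 add0r (lPhi j).2 hornerC.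
  by rewrite tangentD (lPhi j).1 (lPhi j).2 mul1r !hornerE mulrC.
(* At 0 the column of [psi] vanishes outside the row of [w], so the determinant is a nonzero
   multiple of the old minor. *)
have Q0 : (\det Q).[0] != 0.
  rewrite -[_.[_]]/(horner_eval 0 (\det Q)) -det_map_mx (expand_det_col _ ord0).
  rewrite big_ord_recl big1 ?addr0 => [|i _].
    rewrite !mxE /= /horner_eval hornerC /Phi unlift_none mulf_neq0 //.
    rewrite /cofactor mulf_neq0 ?signr_eq0 //.
    suff -> : row' ord0 (col' ord0 (map_mx (horner_eval 0) Q))
        = (\matrix_(i, j) phi j (tangent f (ws i)) : 'M[k]_m) by [].
    apply/matrixP=> i j; rewrite !mxE /= /horner_eval /W /Phi !liftK /= !hornerE.
    by [].
  rewrite !mxE /= /horner_eval /W /Phi liftK unlift_none /= !hornerE psi0 /= ?mul0r //.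
  by have [wu wv] := wf_ws i; exists (ws i).1, (ws i).2; split.
(* One non-root of this product keeps [p] nonzero, the reduced minor nonzero and [x] nonzero at
   once. *)
have nzq : q * \det Q * 'X != 0.
  rewrite !mulf_neq0 ?polyX_eq0 //.
    apply: contra_neq pf0 => q0.
    by rewrite -[f]addr0 -(kscale0r xi) Hq q0 horner0.
  by apply: contra_neq Q0 => ->; rewrite horner0.
have [x] := closed_nonrootP _ nzq; rewrite /root !hornerE.
rewrite !mulf_eq0 !negb_or => /andP[/andP[qx Dx] x0].
exists x; split; first by rewrite Hq.
exists W, Phi; split=> //; last by rewrite Qx mulf_neq0.
by move=> i; rewrite /W; case: unliftP => [h _|_] //=.
Qed.

End Perturbation.

Lemma general_null_shift (l : nat) (th : 'I_l -> 'I_n -> int) :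
  dsum_decomp e th ->
  exists fs : forall i, 'M[A]_(size (P0 (th i)), size (P1 (th i))),
    (forall i, wf e (fs i)) /\
    forall i j, i != j -> forall h, wf e h -> null_shift e (fs j) (fs i) h.
Proof.
rewrite /dsum_decomp /general.
set s := P1 _; set t := P0 _ => -[p [pp [[f0 [wf0 pf0]] Hp]]].
pose Q m := exists f : 'M[A]_(size t, size s), [/\ wf e f, p f != 0 & tangent_rank_ge f m].
have [||m [f [wff pf rf]] mmax] := @ex_max_nat Q (dim {ffun 'I_(size t) * 'I_(size s) -> A}).
- exists 0%N, f0; split=> //.
  by exists (fun=> 0), (fun _ _ => 0); split=> [[]|[]|] //; rewrite det_mx00 oner_eq0.
- by move=> m [f [_ _ /tangent_rank_bound]].
have [fs [wfs [i1 [i0 [p1 [p0 [ci [cp [pi [po _]]]]]]]]]] := Hp f wff pf.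
exists fs; split=> // i j ne_ij z wz.
have [wi1 [wi0 /= Ei]] := ci i; have [wj1 [wj0 /= Ej]] := ci j.
have [wpi1 [wpi0 /= Epi]] := cp i; have [wpj1 [wpj0 /= Epj]] := cp j.

(* [xi] transports [z] to a direction at [f]. [w] is the idempotent of summand [i]; the sign in
   degree 0 makes its tangent vector a commutator with [f], which is zero. *)
pose xi := i0 j *m z *m p1 i.
pose w : 'M[A]_(size s) * 'M[A]_(size t) := (i1 i *m p1 i, - (i0 i *m p0 i)).
have wxi : wf e xi by apply: (wf_mul eK) => //; apply: (wf_mul eK).
have wf_w : wf e w.1 /\ wf e w.2.
  by split; [exact: (wf_mul eK) | apply/wf_opp/(wf_mul eK)].
have fw0 : tangent f w = 0.
  by rewrite /tangent /= mulNmx mulmxA -Ei -!mulmxA Epi subrr.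
have [/= hi [whi [hi0 hi1]]] := pi i.
have [/= hj [whj [hj0 hj1]]] := pi j.

have [/= hij [whij [+ _]]] := po i j ne_ij; rewrite subr0 => hij0.
have {}hi1 := canRL (subrK _) hi1; have {}hj0 := canRL (subrK _) hj0.
(* Otherwise a perturbation along [xi] would exceed the maximal rank inside the same open set. *)
have nst : null_shift e f f (tangent xi w).
  apply: contrapT => nS.
  have [x [px rx]] := tangent_rank_jump pp pf rf wf_w.1 wf_w.2 fw0 nS.
  have /mmax : Q m.+1.
    by exists (f + kscale x xi); split=> //; apply/wf_add/wf_kscale.
  by rewrite ltnn.
(* Up to null classes [tangent xi w] is [xi]: [p1 i *m i1 i] is homotopic to the identity, and
   [p0 i *m i0 j] to zero since [i] and [j] differ. *)
have xiE : xi = tangent xi w + (- (i0 j *m z *m hi *m p0 i)) *m f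
              + f *m (i1 i *m hij *m z *m p1 i).
  have -> : tangent xi w = i0 j *m z *m (p1 i *m i1 i) *m p1 i
                           - i0 i *m (p0 i *m i0 j) *m z *m p1 i.
    by rewrite /tangent /= /xi mulNmx !mulmxA.
  rewrite hi1 hij0 mulmxDr mulmxDl (wf_idmr eK) ?mulNmx; last exact: (wf_mul eK).
  rewrite -(mulmxA _ (p0 i) f) Epi !mulmxA -Ei -/xi.
  by rewrite addrAC subrK addrAC subrr add0r.
have [u [v [wu wv xi_uv]]] : null_shift e f f xi.
  rewrite xiE; apply: null_shiftD; first apply: null_shiftD => //.
    by apply/null_shift_r/wf_opp; do !apply: (wf_mul eK) => //.
  by apply: null_shift_l; do !apply: (wf_mul eK) => //.
(* Compressing [xi] back to the summands returns [z] up to null terms, so nullity of [xi] passes to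
   [z]; [y] is [z] after the homotopy correction at [i]. *)
pose y := z *m hi *m fs i + z.
have wy : wf e y by apply: wf_add => //; do !apply: (wf_mul eK) => //.
have eq_z : p0 j *m xi *m i1 i = fs j *m (hj *m y) + y.
  have -> : p0 j *m xi *m i1 i = (p0 j *m i0 j) *m (z *m (p1 i *m i1 i)).
    by rewrite /xi !mulmxA.
  have -> : z *m (p1 i *m i1 i) = y by rewrite hi1 mulmxDr (wf_idmr eK) // mulmxA.
  by rewrite hj0 mulmxDl (wf_idml eK) // mulmxA.
exists (p1 j *m u *m i1 i - hj *m y), (p0 j *m v *m i0 i - z *m hi).
split.
- by apply/wf_add/wf_opp; do !apply: (wf_mul eK) => //.
- by apply/wf_add/wf_opp; do !apply: (wf_mul eK) => //.
have {}eq_z : z = p0 j *m xi *m i1 i - fs j *m (hj *m y) - z *m hi *m fs i.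
  by rewrite eq_z [_ + y]addrC addrK addrC /y addKr.
rewrite {1}eq_z xi_uv mulmxDr mulmxDl mulmxBr mulmxBl !mulmxA -Epj -(mulmxA _ (i0 i)) Ei.
by rewrite !mulmxA [RHS]addrA; congr (_ - _); exact: addrAC.
Qed.

End GeneralMorphism.

(** * Modules and their stable subspaces *)

Section Modules.
Variables (k : closedFieldType) (A : falgType k).
Implicit Types X Y Z : fmod A.

Lemma fmod_actD X a b : fact X (a + b) = fact X a + fact X b.
Proof. by have := fact_lin X 1 a b; rewrite !scale1r. Qed.

Lemma fmod_act0 X : fact X 0 = 0.
Proof. by apply: (addrI (fact X 0)); rewrite -fmod_actD !addr0. Qed.

Lemma fmod_act_sum X (I : Type) (s : seq I) (F : I -> A) :
  fact X (\sum_(i <- s) F i) = \sum_(i <- s) fact X (F i).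
Proof. exact: (big_morph _ (fmod_actD X) (fmod_act0 X)). Qed.

Definition stable X m (V : 'M[k]_(m, fdim X)) := forall a, (V *m fact X a <= V)%MS.

Lemma stable_eqmx X m1 m2 (V : 'M[k]_(m1, fdim X)) (W : 'M[k]_(m2, fdim X)) :
  (V :=: W)%MS -> stable V -> stable W.
Proof. by move=> eqVW sV a; rewrite -eqVW -(eqmxMr _ eqVW). Qed.

(** The rows of [N *m pinvmx N - 1%:M] lie in the kernel of [N], which [B] kills. This is how maps
    out of quotients are induced. *)
Lemma full_factor d r m (N : 'M[k]_(d, r)) (B : 'M[k]_(d, m)) :
  kermx N *m B = 0 -> N *m (pinvmx N *m B) = B.
Proof.
move=> kNB; apply/eqP; rewrite -subr_eq0 mulmxA -{2}[B]mul1mx -mulmxBl.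
have /submxP[C ->] : (N *m pinvmx N - 1%:M <= kermx N)%MS.
  by apply/sub_kermxP; rewrite mulmxBl mul1mx mulmxKpV ?subrr.
by rewrite -mulmxA kNB mulmx0.
Qed.

Lemma mhom_mul X Y Z (M : 'M[k]_(fdim X, fdim Y)) (N : 'M[k]_(fdim Y, fdim Z)) :
  mhom M -> mhom N -> mhom (X := X) (Y := Z) (M *m N).
Proof. by move=> hM hN a; rewrite mulmxA hM -mulmxA hN mulmxA. Qed.

Lemma mhom_cancel_full X Y Z (M : 'M[k]_(fdim X, fdim Y)) (N : 'M[k]_(fdim Y, fdim Z)) :
  mhom M -> row_full M -> mhom (X := X) (Y := Z) (M *m N) -> mhom N.
Proof.
move=> hM fM hMN a; apply: (row_full_inj fM).
by rewrite mulmxA -hM -mulmxA hMN mulmxA.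
Qed.

Lemma mhom_cancel_free X Y Z (M : 'M[k]_(fdim X, fdim Y)) (N : 'M[k]_(fdim Y, fdim Z)) :
  mhom N -> row_free N -> mhom (X := X) (Y := Z) (M *m N) -> mhom M.
Proof.
move=> hN fN hMN a; apply: (row_free_inj fN).
by rewrite -[RHS]mulmxA hN -mulmxA hMN mulmxA.
Qed.

Lemma mhom_stable X Y m (M : 'M[k]_(fdim X, fdim Y)) (V : 'M[k]_(m, fdim X)) :
  mhom M -> stable V -> stable (X := Y) (V *m M).
Proof. by move=> hM sV a; rewrite -mulmxA -hM mulmxA submxMr. Qed.

Lemma ker_stable X Y (M : 'M[k]_(fdim X, fdim Y)) : mhom M -> stable (X := X) (kermx M).
Proof.
by move=> hM a; apply/sub_kermxP; rewrite -mulmxA hM mulmxA mulmx_ker mul0mx.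
Qed.

Lemma cap_stable X m1 m2 (V : 'M[k]_(m1, fdim X)) (W : 'M[k]_(m2, fdim X)) :
  stable V -> stable W -> stable (V :&: W)%MS.
Proof.
move=> sV sW a; rewrite sub_capmx.
by rewrite (submx_trans (submxMr _ (capmxSl V W))) // (submx_trans (submxMr _ (capmxSr V W))).
Qed.

Lemma stable1 X : stable (1%:M : 'M[k]_(fdim X)).
Proof. by move=> a; rewrite submx1. Qed.

Lemma stable0 X : stable (0 : 'M[k]_(fdim X)).
Proof. by move=> a; rewrite mul0mx sub0mx. Qed.

Lemma sub_fmod X m (V : 'M[k]_(m, fdim X)) : stable V ->
  exists Y (M : 'M[k]_(fdim Y, fdim X)), [/\ mhom M, row_free M & (M :=: V)%MS].
Proof.
move=> sV; set B := row_base V; have freeB : row_free B := row_base_free V.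
have actB a : B *m fact X a *m pinvmx B *m B = B *m fact X a.
  by rewrite mulmxKpV // eq_row_base (eqmxMr _ (eq_row_base V)).
have H1 a b : B *m fact X (a * b) *m pinvmx B
    = (B *m fact X a *m pinvmx B) *m (B *m fact X b *m pinvmx B).
  apply: (row_free_inj freeB); rewrite /= actB -[RHS]mulmxA actB.
  by rewrite [RHS]mulmxA actB fact_mul mulmxA.
have H2 : B *m fact X 1 *m pinvmx B = 1%:M.
  by apply: (row_free_inj freeB); rewrite /= actB fact_one mulmx1 mul1mx.
have H3 c a b : B *m fact X (c *: a + b) *m pinvmx B
    = c *: (B *m fact X a *m pinvmx B) + B *m fact X b *m pinvmx B.
  by rewrite fact_lin mulmxDr mulmxDl -scalemxAr -scalemxAl.
exists (FMod H1 H2 H3), B; split=> //; exact: eq_row_base.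
Qed.

(** A column base of [cokermx V] is a surjection with kernel [V]; stability of [V] lets the action
    descend along it. *)
Lemma quo_fmod X m (V : 'M[k]_(m, fdim X)) : stable V ->
  exists Y (M : 'M[k]_(fdim X, fdim Y)), [/\ mhom M, row_full M & (kermx M :=: V)%MS].
Proof.
move=> sV; set P := col_base (cokermx V).
have fullP : row_full P := col_base_full _.
have kerP : (kermx P :=: V)%MS.
  apply/eqmxP/andP; split.
    rewrite submxE; apply/eqP.
    transitivity (kermx P *m (P *m row_base (cokermx V))); first by rewrite mulmx_base.
    by rewrite mulmxA mulmx_ker mul0mx.
  apply/sub_kermxP; apply: (row_free_inj (row_base_free (cokermx V))).
  by rewrite /= -mulmxA mulmx_base mulmx_coker mul0mx.
have actP a : P *m (pinvmx P *m (fact X a *m P)) = fact X a *m P.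
  apply: full_factor; rewrite mulmxA; apply/sub_kermxP.
  exact: (stable_eqmx (eqmx_sym kerP) sV).
have H1 a b : pinvmx P *m (fact X (a * b) *m P)
    = (pinvmx P *m (fact X a *m P)) *m (pinvmx P *m (fact X b *m P)).
  apply: (row_full_inj fullP).
  by rewrite /= actP [RHS]mulmxA actP -[RHS]mulmxA actP fact_mul -mulmxA.
have H2 : pinvmx P *m (fact X 1 *m P) = 1%:M.
  by rewrite fact_one mul1mx mulVpmx.
have H3 c a b : pinvmx P *m (fact X (c *: a + b) *m P)
    = c *: (pinvmx P *m (fact X a *m P)) + pinvmx P *m (fact X b *m P).
  by rewrite fact_lin mulmxDl mulmxDr -scalemxAl -scalemxAr.
exists (FMod H1 H2 H3), P; split=> //.
by move=> a /=; rewrite actP.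
Qed.

Lemma preim_stable X Y m (M : 'M[k]_(fdim X, fdim Y)) (V : 'M[k]_(m, fdim Y)) :
  mhom M -> row_full M -> stable V ->
  exists W : 'M[k]_(fdim X), [/\ stable W, (W *m M :=: V)%MS & (kermx M <= W)%MS].
Proof.
move=> hM fM sV; pose W := kermx (M *m cokermx V).
have WP m' (v : 'M_(m', _)) : (v <= W)%MS = (v *m M <= V)%MS.
  by rewrite [RHS]submxE -mulmxA; apply/sub_kermxP/eqP.
have WM : (W *m M <= V)%MS by rewrite -WP.
exists W; split; last by rewrite WP mulmx_ker sub0mx.
  move=> a; rewrite WP -mulmxA hM mulmxA.
  exact: submx_trans (submxMr _ WM) (sV a).
apply/eqmxP; rewrite WM /= -[V in (V <= _)%MS]mulmx1 -(mulVpmx fM) mulmxA.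
by rewrite submxMr // WP -mulmxA mulVpmx // mulmx1.
Qed.

End Modules.

(** The real score depends only on [g x], which takes finitely many values, so its maximum is
    attained; [r] then breaks ties. *)
Lemma lex_max (R : realType) (T : Type) (P : T -> Prop) (F : finType) (g : T -> F)
    (s : F -> R) (r : T -> nat) (N : nat) :
  (exists x, P x) -> (forall x, P x -> (r x <= N)%N) ->
  exists x, P x /\ forall y, P y ->
    s (g y) < s (g x) \/ s (g y) = s (g x) /\ (r y <= r x)%N.
Proof.
move=> [x0 Px0] rN; pose Q a := `[< exists2 x, P x & g x = a >].
have Qx0 : Q (g x0) by apply/asboolP; exists x0.
case: (Order.TotalTheory.arg_maxP s Qx0) => a /asboolP[x1 Px1 gx1] amax.
have [||m [x [Px gx rx]] mmax] :=
  @ex_max_nat (fun m => exists x, [/\ P x, s (g x) = s a & r x = m]) N.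
- by exists (r x1), x1; rewrite gx1.
- by move=> m [x [Px _ <-]]; apply: rN.
exists x; split=> // y Py; rewrite gx.
have : s (g y) <= s a by apply: amax; apply/asboolP; exists y.
rewrite le_eqVlt => /orP[/eqP gy|]; [right | by left].
by split=> //; rewrite rx; apply: mmax; exists y.
Qed.

(** * Semistability expressed through stable subspaces *)

Section Semistability.
Variables (k : closedFieldType) (A : falgType k) (n : nat) (e : 'I_n -> A).
Hypothesis eK : forall i, e i * e i = e i.
Variable R : realType.
Implicit Types (X Y Z : fmod A) (th : 'I_n -> R).

(** For stable [V], the value of [th] on the submodule with row space [V], without constructing that
    module. *)
Definition evS th X m (V : 'M[k]_(m, fdim X)) : R :=
  \sum_(i < n) th i * (\rank (V *m fact X (e i)))%:R.

Lemma evK_evS th X : evK e th X = evS th (1%:M : 'M_(fdim X)).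
Proof. by apply: eq_bigr => i _; rewrite mul1mx. Qed.

Lemma eqmx_evS th X m1 m2 (V : 'M[k]_(m1, fdim X)) (W : 'M[k]_(m2, fdim X)) :
  (V :=: W)%MS -> evS th V = evS th W.
Proof. by move=> eqVW; apply: eq_bigr => i _; rewrite (eqmxMr _ eqVW). Qed.

Lemma evS_full th X m (V : 'M[k]_(m, fdim X)) :
  \rank V = fdim X -> evS th V = evK e th X.
Proof.
move=> rV; rewrite evK_evS; apply: eqmx_evS; apply/eqmxP.
by rewrite submx1 sub1mx -col_leq_rank rV leqnn.
Qed.

Lemma evS0 th X m (V : 'M[k]_(m, fdim X)) : \rank V = 0%N -> evS th V = 0.
Proof.
move=> /eqP; rewrite mxrank_eq0 => /eqP->.
by rewrite /evS big1 // => i _; rewrite mul0mx mxrank0 mulr0.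
Qed.

(** A vector of [V e_i] is fixed by the idempotent [e_i], so if it also lies in [W] it comes from
    the intersection. This is exactness of passing to [X e_i], and it makes [evS] additive. *)
Lemma stable_cap_idem X m1 m2 (V : 'M[k]_(m1, fdim X)) (W : 'M[k]_(m2, fdim X)) i :
  stable V -> stable W ->
  (V *m fact X (e i) :&: W :=: (V :&: W) *m fact X (e i))%MS.
Proof.
move=> sV sW; apply/eqmxP/andP; split; last first.
  rewrite sub_capmx submxMr ?capmxSl //.
  by rewrite (submx_trans (submxMr _ (capmxSr V W))).
have xe m (U : 'M_(m, _)) : (U <= V *m fact X (e i))%MS -> U = U *m fact X (e i).
  by move=> /submxP[C ->]; rewrite -!mulmxA -fact_mul eK.
rewrite [X in (X <= _)%MS]xe ?capmxSl // submxMr // sub_capmx capmxSr andbT.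
exact: submx_trans (capmxSl _ _) (sV _).
Qed.

Lemma evS_mul_ker th X Y (M : 'M[k]_(fdim X, fdim Y)) m (V : 'M[k]_(m, fdim X)) :
  mhom M -> stable V -> evS th V = evS th (X := Y) (V *m M) + evS th (V :&: kermx M)%MS.
Proof.
move=> hM sV; rewrite -big_split; apply: eq_bigr => i _ /=.
rewrite -mulrDr -natrD -mulmxA -hM mulmxA.
by rewrite -(stable_cap_idem i sV (ker_stable hM)) mxrank_mul_ker.
Qed.

Lemma evS_mul_free th X Y (M : 'M[k]_(fdim X, fdim Y)) m (V : 'M[k]_(m, fdim X)) :
  mhom M -> row_free M -> evS th (X := Y) (V *m M) = evS th V.
Proof.
move=> hM fM; apply: eq_bigr => i _.
by rewrite -mulmxA -hM mulmxA mxrankMfree.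
Qed.

Lemma factor_of_trans X Y Z : factor_of X Y -> factor_of Y Z -> factor_of X Z.
Proof.
move=> [M [hM fM]] [N [hN fN]]; exists (M *m N); split; first exact: mhom_mul hM hN.
by rewrite /row_full (eqmxMfull _ fM).
Qed.

Lemma submod_of_trans X Y Z : submod_of X Y -> submod_of Y Z -> submod_of X Z.
Proof.
move=> [M [hM fM]] [N [hN fN]]; exists (N *m M); split; first exact: mhom_mul hN hM.
by rewrite /row_free mxrankMfree.
Qed.

Lemma factor_of_ker X Y : factor_of X Y ->
  exists V : 'M[k]_(fdim X), [/\ stable V, forall th, evK e th X = evK e th Y + evS th V
    & (fdim X = fdim Y + \rank V)%N].
Proof.
move=> [M [hM fM]]; exists (kermx M); split; first exact: ker_stable hM.
  move=> th; rewrite evK_evS (evS_mul_ker _ hM (@stable1 _ _ X)).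
  rewrite cap1mx mul1mx (evS_full _ (eqP fM)); first by [].
by rewrite mxrank_ker (eqP fM) subnKC // -(eqP fM) rank_leq_row.
Qed.

Lemma factor_of_quo X m (V : 'M[k]_(m, fdim X)) : stable V ->
  exists Y, [/\ factor_of X Y, forall th, evK e th X = evK e th Y + evS th V
    & (fdim X = fdim Y + \rank V)%N].
Proof.
move=> sV; have [Y [M [hM fM kM]]] := quo_fmod sV; exists Y; split; first by exists M.
  move=> th; rewrite evK_evS (evS_mul_ker _ hM (@stable1 _ _ X)).
  by rewrite cap1mx (eqmx_evS _ kM) mul1mx (evS_full _ (eqP fM)).
by rewrite -kM mxrank_ker (eqP fM) subnKC // -(eqP fM) rank_leq_row.
Qed.

Lemma submod_of_im X Y : submod_of X Y ->
  exists V : 'M[k]_(fdim X), [/\ stable V, forall th, evK e th Y = evS th V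
    & fdim Y = \rank V].
Proof.
move=> [M [hM fM]]; exists <<M>>%MS; split.
- apply: (stable_eqmx (X := X) (eqmx_sym (genmxE M))).
  by rewrite -[M]mul1mx; apply: mhom_stable hM (@stable1 _ _ Y).
- move=> th; rewrite (eqmx_evS _ (genmxE M)) -[M in RHS]mul1mx.
  by rewrite evS_mul_free // evK_evS.
- by rewrite mxrank_gen (eqP fM).
Qed.

Lemma submod_of_stable X m (V : 'M[k]_(m, fdim X)) : stable V ->
  exists Y, [/\ submod_of X Y, forall th, evK e th Y = evS th V & fdim Y = \rank V].
Proof.
move=> sV; have [Y [M [hM fM MV]]] := sub_fmod sV; exists Y; split; first by exists M.
  move=> th; rewrite -(eqmx_evS _ MV) -[M]mul1mx.
  by rewrite evS_mul_free // evK_evS.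
by rewrite -MV (eqP fM).
Qed.

Lemma Tbar_stable th X : Tbar e th X <->
  forall V : 'M[k]_(fdim X), stable V -> evS th V <= evK e th X.
Proof.
split=> [TX V /factor_of_quo[Y [XY -> _]] | TX Y /factor_of_ker[V [sV eqV _]]].
  by rewrite lerDr TX.
by have := TX V sV; rewrite eqV lerDr.
Qed.

Lemma Tss_stable th X : Tss e th X <->
  forall V : 'M[k]_(fdim X), stable V -> (\rank V < fdim X)%N -> evS th V < evK e th X.
Proof.
split=> [TX V /factor_of_quo[Y [XY -> eqd]] | TX Y /factor_of_ker[V [sV eqV eqd]] Y0].
  by rewrite [X in (_ < X)%N]eqd addnC -[X in (X < _)%N]addn0 ltn_add2l => Y0; rewrite ltrDr TX.
have := TX V sV; rewrite eqV ltrDr; apply.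
by rewrite [X in (_ < X)%N]eqd addnC -[X in (X < _)%N]addn0 ltn_add2l.
Qed.

Lemma Fbar_stable th X : Fbar e th X <->
  forall V : 'M[k]_(fdim X), stable V -> evS th V <= 0.
Proof.
split=> [FX V /submod_of_stable[Y [XY <- _]] | FX Y /submod_of_im[V [sV -> _]]].
  exact: FX.
exact: FX.
Qed.

Lemma Fss_stable th X : Fss e th X <->
  forall V : 'M[k]_(fdim X), stable V -> (0 < \rank V)%N -> evS th V < 0.
Proof.
split=> [FX V /submod_of_stable[Y [XY <- <-]] | FX Y /submod_of_im[V [sV -> ->]]].
  exact: FX.
exact: FX.
Qed.

Lemma stable_lex_max th X (r : 'M[k]_(fdim X) -> nat) :
  (forall V, (r V <= fdim X)%N) ->
  exists V : 'M[k]_(fdim X), stable V /\ forall W : 'M[k]_(fdim X), stable W ->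
    evS th W < evS th V \/ evS th W = evS th V /\ (r W <= r V)%N.
Proof.
move=> rX.
(* [g] is the dimension vector, bounded by [fdim X] in each entry, and it determines the value of
   [th]. *)
pose g (V : 'M[k]_(fdim X)) : {ffun 'I_n -> 'I_(fdim X).+1} :=
  [ffun i => inord (\rank (V *m fact X (e i)))].
pose s (a : {ffun 'I_n -> 'I_(fdim X).+1}) : R := \sum_i th i * (a i : nat)%:R.
have gE V : s (g V) = evS th V.
  by apply: eq_bigr => i _; rewrite ffunE inordK // ltnS rank_leq_col.
have [|V [sV Vmax]] := @lex_max R _ (@stable _ _ X _) _ g s r (fdim X) _ (fun V _ => rX V).
  by exists 0; apply: stable0.
by exists V; split=> // W sW; rewrite -!gE; apply: Vmax.
Qed.

(** [Z] is [X / V] with [V] of largest value and then of largest rank: a nonzero submodule of [Z]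
    lifts to a strictly larger subspace, hence of smaller value. If [Z] were zero, [X] itself would
    have the largest value. *)
Lemma not_Tbar th X : ~ Tbar e th X ->
  exists Z, [/\ factor_of X Z, Fss e th Z & (0 < fdim Z)%N].
Proof.
move=> nT; have [V [sV Vmax]] := stable_lex_max th (fun V : 'M[k]_(fdim X) => rank_leq_row V).
have [Z [M [hM fM kM]]] := quo_fmod sV; exists Z; split; first by exists M.
  apply/Fss_stable => W' sW' W'0; have [W [sW WM kW]] := preim_stable hM fM sW'.
  have capW : (W :&: kermx M :=: V)%MS by apply: eqmx_trans kM; apply/capmx_idPr.
  have := Vmax W sW; rewrite (evS_mul_ker _ hM sW) (eqmx_evS _ WM) (eqmx_evS _ capW).
  rewrite gtrDr => -[//|[_]]; rewrite -(mxrank_mul_ker W M) WM capW.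
  by rewrite -[X in (_ <= X)%N]add0n leq_add2r leqNgt W'0.
rewrite lt0n; apply/eqP=> Z0; apply: nT; apply/Tbar_stable => W sW.
have rV : \rank V = fdim X.
  apply/eqP; rewrite eqn_leq rank_leq_row -kM mxrank_ker (eqP fM) Z0 subn0 leqnn.
  by [].
rewrite -(evS_full th rV).
by case: (Vmax W sW) => [/ltW|[->]].
Qed.

(** Dually, [Z] is a submodule of largest value and then of smallest rank, so its proper submodules
    have strictly smaller value. *)
Lemma not_Fbar th X : ~ Fbar e th X ->
  exists Z, [/\ submod_of X Z, Tss e th Z & (0 < fdim Z)%N].
Proof.
move=> nF; have [V [sV Vmax]] :=
  stable_lex_max th (fun V : 'M[k]_(fdim X) => leq_subr (\rank V) (fdim X)).
have [Z [M [hM fM MV]]] := sub_fmod sV; exists Z; split; first by exists M.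
  apply/Tss_stable => W sW ltW.
  have sWM : stable <<W *m M>>%MS.
    by apply: (stable_eqmx (X := X) (eqmx_sym (genmxE _))); apply: mhom_stable.
  have := Vmax _ sWM; rewrite (eqmx_evS _ (genmxE _)) mxrank_gen mxrankMfree //.
  have -> : evS th V = evK e th Z.
    by rewrite evK_evS -(evS_mul_free _ _ hM fM) mul1mx (eqmx_evS _ MV).
  rewrite evS_mul_free //.
  case=> // -[_]; rewrite leq_sub2lE ?rank_leq_row // -MV (eqP fM) leqNgt ltW //.
rewrite lt0n; apply/eqP=> Z0; apply: nF; apply/Fbar_stable => W sW.
have <- : evS th V = 0 by apply: evS0; rewrite -MV (eqP fM).
by case: (Vmax W sW) => [/ltW|[->]].
Qed.

End Semistability.

(** * Orthogonality of the summands *)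

Section HomSpaces.
Variables (k : closedFieldType) (A : falgType k) (n : nat) (e : 'I_n -> A).
Hypothesis eK : forall i, e i * e i = e i.
Variable X : fmod A.
Local Notation d := (fdim X).
Implicit Types W : 'M[k]_d.

(* [hom_space s W] is the row space Hom_A(P_s, W) = (+)_a W e_(s_a), for a stable
   subspace [W] of [X], and [precomp M] is precomposition with [M : P_s -> P_t],
   from Hom_A(P_t, X) to Hom_A(P_s, X). *)
Definition hom_space (s : seq 'I_n) W := \mxdiag_(a < size s) (W *m fact X (e (oidx a))).
Definition precomp (r c : nat) (M : 'M[A]_(r, c)) :=
  \mxblock_(a < r, b < c) fact X (M a b).

Lemma precomp_mul r m c (M : 'M[A]_(r, m)) (N : 'M[A]_(m, c)) :
  precomp (M *m N) = precomp M *m precomp N.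
Proof.
rewrite mul_mxblock; apply: eq_mxblock => a b; rewrite mxE fmod_act_sum.
by apply: eq_bigr => i _; rewrite fact_mul.
Qed.

Lemma precompD r c (M N : 'M[A]_(r, c)) : precomp (M + N) = precomp M + precomp N.
Proof. by rewrite -mxblockD; apply: eq_mxblock => a b; rewrite mxE fmod_actD. Qed.

Lemma rank_hom_space s W :
  \rank (hom_space s W) = \sum_(i <- s) \rank (W *m fact X (e i)).
Proof. by rewrite rank_mxdiag (big_tnth _ _ s). Qed.

Lemma sum_flatten_nseq (m g : 'I_n -> nat) :
  \sum_(i <- flatten [seq nseq (m i) i | i <- enum 'I_n]) g i = \sum_i m i * g i.
Proof.
rewrite big_flatten big_map enumT; apply: eq_bigr => i _.
by rewrite big_nseq iter_addn_0 mulnC.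
Qed.

(** Hom from [P(i)] to [W] is [W e_i], so the value is the Euler form of the 2-term complex against
    [W]. Signs of [th] thus become comparisons of Hom dimensions. *)
Lemma evS_hom_space (R : realType) (th : 'I_n -> int) W :
  evS e (toR R th) W = (\rank (hom_space (P0 th) W))%:R - (\rank (hom_space (P1 th) W))%:R.
Proof.
rewrite !rank_hom_space !sum_flatten_nseq !natr_sum -sumrB.
apply: eq_bigr => i _; rewrite !natrM -mulrBl; congr (_ * _).
rewrite /toR /negpart /pospart oppr_ge0.
case: (th i) => [[|m]|m] /=; rewrite ?subr0 ?sub0r //.
Qed.

Lemma hom_spaceP s W (z : 'rV[k]_(\sum_(a < size s) d)) :
  (z <= hom_space s W)%MS <->
  forall a, (submxrow z a <= W *m fact X (e (oidx a)))%MS.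
Proof.
split=> [/submxP[C ->] a | zW].
  by rewrite -[C]submxrowK mul_mxrow_mxdiag mxrowK submxMl.
apply/submxP; exists (\mxrow_a (submxrow z a *m pinvmx (W *m fact X (e (oidx a))))).
rewrite mul_mxrow_mxdiag -[LHS]submxrowK; apply: eq_mxrow => a.
by rewrite mulmxKpV.
Qed.

Lemma hom_space_idem s W (z : 'rV[k]_(\sum_(a < size s) d)) a :
  (z <= hom_space s W)%MS -> submxrow z a *m fact X (e (oidx a)) = submxrow z a.
Proof. by move=> /hom_spaceP/(_ a)/submxP[C ->]; rewrite -!mulmxA -fact_mul eK. Qed.

Lemma hom_space_mono s W1 W2 : (W1 <= W2)%MS -> (hom_space s W1 <= hom_space s W2)%MS.
Proof.
move=> W12; apply/rV_subP => z /hom_spaceP zW; apply/hom_spaceP => a.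
exact: submx_trans (zW a) (submxMr _ W12).
Qed.

Lemma hom_space0 s : hom_space s 0 = 0.
Proof. by rewrite -[RHS]mxdiag0; apply: eq_mxdiag => a; rewrite mul0mx. Qed.

Lemma hom_space_precomp s t (M : 'M[A]_(size t, size s)) W :
  wf e M -> stable W -> (hom_space t W *m precomp M <= hom_space s W)%MS.
Proof.
move=> wM sW; rewrite mul_mxdiag_mxblock.
have -> : \mxblock_(a < size t, b < size s) (W *m fact X (e (oidx a)) *m fact X (M a b))
  = (\mxblock_(a < size t, b < size s) (W *m fact X (M a b) *m pinvmx W)) *m hom_space s W.
  rewrite mul_mxblock_mxdiag; apply: eq_mxblock => a b.
  rewrite [RHS]mulmxA mulmxKpV // -!mulmxA -!fact_mul; congr (_ *m fact X _).
  by rewrite [in RHS]wM -[RHS]mulrA eK -wM [in LHS]wM !mulrA eK -wM.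
exact: submxMl.
Qed.

End HomSpaces.

Section Orthogonality.
Variables (k : closedFieldType) (A : falgType k) (n : nat) (e : 'I_n -> A).
Hypothesis eK : forall i, e i * e i = e i.
Variables (R : realType) (X : fmod A).
Local Notation d := (fdim X).
Local Notation D := (hom_space e).
Variables (th1 th2 : 'I_n -> int).

Lemma hom_space_mxcol s (W : 'M[k]_d) (lam : 'cV[k]_(\sum_(b < size s) d)) :
  D s W *m lam = \mxcol_b (W *m fact X (e (oidx b)) *m submxcol lam b).
Proof. by rewrite -[lam in LHS]submxcolK mul_mxdiag_mxcol. Qed.

(** Elementary morphisms, on which the vanishing hypothesis is tested one component at a time. *)
Definition single (s t : seq 'I_n) (a : 'I_(size t)) (b : 'I_(size s)) (x : A) :
    'M[A]_(size t, size s) :=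
  \matrix_(i, j) if (i == a) && (j == b) then e (oidx a) * x * e (oidx b) else 0.

Lemma wf_single s t a b x : wf e (@single s t a b x).
Proof.
move=> i j; rewrite !mxE; case: ifP => [/andP[/eqP-> /eqP->]|_].
  by rewrite !mulrA eK -!mulrA eK.
by rewrite mulr0 mul0r.
Qed.

Lemma mul_single s t a b x (z : 'rV[k]_(\sum_(i < size t) d))
    (lam : 'cV[k]_(\sum_(j < size s) d)) :
  z *m precomp X (@single s t a b x) *m lam =
  submxrow z a *m fact X (e (oidx a) * x * e (oidx b)) *m submxcol lam b.
Proof.
rewrite -[z in LHS]submxrowK mul_mxrow_mxblock -[lam in LHS]submxcolK mul_mxrow_mxcol.
rewrite (bigD1 b) //= [X in _ + X]big1 ?addr0 => [|j jb].
  rewrite (bigD1 a) //= mxE !eqxx big1 ?addr0 // => i ia.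
  by rewrite mxE (negbTE ia) fmod_act0 mulmx0.
rewrite big1 ?mul0mx // => i _.
by rewrite mxE (negbTE jb) andbF fmod_act0 mulmx0.
Qed.

Lemma Fss_evK_le0 (f1 : 'M[A]_(size (P0 th1), size (P1 th1)))
    (f2 : 'M[A]_(size (P0 th2), size (P1 th2))) :
  wf e f2 -> (forall h, wf e h -> null_shift e f2 f1 h) ->
  Fss e (toR R th1) X -> evK e (toR R th2) X <= 0.
Proof.
move=> wf2 null /Fss_stable FX.
(* [good W] says that Hom(P_f2, X/W) = 0; a minimal good [W] is shown to be 0. *)
pose good (W : 'M[k]_d) := stable (X := X) W /\
  forall z : 'rV_(\sum_(a < size (P0 th2)) d), (z <= D (P0 th2) 1%:M)%MS ->
    (z *m precomp X f2 <= D (P1 th2) W)%MS -> (z <= D (P0 th2) W)%MS.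
suff [W rW [sW gW]] : exists2 W, \rank W = 0%N & good W.
  have W0 : W = 0 by apply/eqP; rewrite -mxrank_eq0 rW.
  (* For [W = 0], goodness makes precomposition with [f2] injective, which bounds dim Hom(P_0, X) by
     dim Hom(P_1, X). *)
  rewrite evK_evS evS_hom_space subr_le0 ler_nat.
  rewrite -(mxrank_mul_ker (D (P0 th2) 1%:M) (precomp X f2)).
  rewrite (_ : (_ :&: _)%MS = 0) ?mxrank0 ?addn0.
    by apply/mxrankS/hom_space_precomp; [exact: eK | | exact: stable1].
  apply/eqP; rewrite -submx0; apply/rV_subP => z; rewrite sub_capmx => /andP[zD /sub_kermxP z0].
  by have := gW z zD; rewrite W0 !hom_space0 z0 sub0mx; apply.
have : good 1%:M by split=> [|z //]; apply: stable1.
have [r] := ubnP (\rank (1%:M : 'M[k]_d)); elim: r (1%:M : 'M[k]_d) => // r IHr W rW gW.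
have [W0|W0] := posnP (\rank W); first by exists W.
(* [W'] is the largest submodule of [W] on which a functional [lam] on
   Hom(P_1, W) vanishing on the image of [f1] is zero. *)
suff [W' ltW gW'] : exists2 W' : 'M_d, (\rank W' < \rank W)%N & good W'.
  by apply: (IHr W') => //; apply: leq_trans ltW _.
case: gW => sW gW; have := FX W sW W0.
rewrite evS_hom_space subr_lt0 ltr_nat => lt_rank.
(* As [th1] is negative on [W], Hom(P_1, W) is larger than Hom(P_0, W); [lam] is read off the
   cokernel of precomposition with [f1]. *)
have [lam lam0 lam1] : exists2 lam : 'cV[k]_(\sum_(b < size (P1 th1)) d),
    D (P0 th1) W *m precomp X f1 *m lam = 0 & D (P1 th1) W *m lam != 0.
  pose C := cokermx (D (P0 th1) W *m precomp X f1).
  have /matrix0Pn[i0 [j nz]] : D (P1 th1) W *m C != 0.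
    rewrite -submxE; apply/negP=> /mxrankS; rewrite leqNgt => /negP; apply.
    exact: leq_ltn_trans (mxrankM_maxl _ _) lt_rank.
  exists (C *m delta_mx j (0 : 'I_1)); first by rewrite mulmxA mulmx_coker mul0mx.
  by apply/matrix0Pn; exists i0, 0; rewrite mulmxA -colE mxE.
have [||W' W'P] := @rowspace_pred k d (fun w => (w <= W)%MS /\ forall b x,
    w *m fact X x *m fact X (e (oidx b)) *m submxcol lam b = 0).
- by split=> [|b x]; rewrite ?sub0mx ?mul0mx.
- move=> c u v [uW u0] [vW v0]; split; first by rewrite addmx_sub ?scalemx_sub.
  by move=> b x; rewrite !mulmxDl -!scalemxAl u0 v0 scaler0 addr0.
have W'W : (W' <= W)%MS by apply/rV_subP => w /W'P[].
have sW' : stable (X := X) W'.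
  move=> y; apply/row_subP => i; rewrite row_mul; apply/W'P.
  have /W'P[rW' r0] := row_sub i W'; split=> [|b' y'].
    exact: submx_trans (submxMr _ rW') (sW y).
  by rewrite -(mulmxA _ (fact X y)) -fact_mul.
have lamW' (U : 'M[k]_d) : (U <= W')%MS -> D (P1 th1) U *m lam = 0.
  move=> UW'; rewrite hom_space_mxcol -[RHS]mxcol0; apply: eq_mxcol => b.
  apply/row_matrixP => i; rewrite !row_mul row0.
  have /W'P[_ /(_ b 1)] : (row i U <= W')%MS by rewrite (submx_trans (row_sub _ _)).
  by rewrite fact_one mulmx1.
exists W'.
  rewrite ltnNge (geq_leqif (mxrank_leqif_sup W'W)); apply/negP => WW'.
  by move/eqP: lam1; apply; apply: lamW'.
split=> // z zD zf.
have zW : (z <= D (P0 th2) W)%MS.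
  by apply: gW => //; apply: submx_trans zf (hom_space_mono _ _ _).
apply/hom_spaceP => a; rewrite -(hom_space_idem eK a zD); apply: submxMr; apply/W'P.
have zaW : (submxrow z a <= W)%MS.
  by have /hom_spaceP/(_ a) := zW; move/submx_trans; apply; apply: sW.
split=> // b x.
(* The test morphism is [f2 u + v f1]. The first term sends [z] into Hom(P_1, W'), where [lam] is
   zero; the second lands in the image of [f1], also killed by [lam]. *)
have [u [v [wu wv eqh]]] := null _ (wf_single a b x).
have := mul_single a b x z lam.
rewrite eqh precompD !precomp_mul mulmxDr mulmxDl !fact_mul !mulmxA (hom_space_idem eK a zD).
move=> <-; rewrite (_ : _ *m precomp X u *m lam = 0) ?add0r.
  have /submxP[c ->] : (z *m precomp X v <= D (P0 th1) W)%MS.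
    exact: submx_trans (submxMr _ zW) (hom_space_precomp eK wv sW).
  by rewrite -!mulmxA [_ *m (_ *m lam)]mulmxA lam0 mulmx0.
have /submxP[c ->] : (z *m precomp X f2 *m precomp X u <= D (P1 th1) W')%MS.
  exact: submx_trans (submxMr _ zf) (hom_space_precomp eK wu sW').
by rewrite -mulmxA lamW' // mulmx0.
Qed.

Lemma Tss_evK_ge0 (f1 : 'M[A]_(size (P0 th1), size (P1 th1)))
    (f2 : 'M[A]_(size (P0 th2), size (P1 th2))) :
  wf e f1 -> wf e f2 -> (forall h, wf e h -> null_shift e f1 f2 h) ->
  Tss e (toR R th1) X -> 0 <= evK e (toR R th2) X.
Proof.
move=> wf1 wf2 null /(Tss_stable eK) TX.
(* [good W] says that Hom(P_f2, W[1]) = 0; a maximal good [W] is shown to be [X]. *)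
pose good (W : 'M[k]_d) := stable (X := X) W /\
  (D (P1 th2) W <= D (P0 th2) W *m precomp X f2)%MS.
suff [W rW [sW gW]] : exists2 W, \rank W = d & good W.
  rewrite -(evS_full e _ rW) evS_hom_space subr_ge0 ler_nat.
  exact: leq_trans (mxrankS gW) (mxrankM_maxl _ _).
have : good 0 by split; [exact: stable0 | rewrite !hom_space0 sub0mx].
have [r] := ubnP (d - \rank (0 : 'M[k]_d)); elim: r (0 : 'M[k]_d) => // r IHr W rW gW.
have := rank_leq_row W; rewrite leq_eqVlt => /predU1P[W1|W1]; first by exists W.
(* [W'] is generated by [W] and a nonzero morphism [z] from P_f1 to X/W. *)
suff [W' ltW gW'] : exists2 W' : 'M_d, (\rank W < \rank W')%N & good W'.
  by apply: (IHr W') => //; apply: leq_trans (ltn_sub2l W1 ltW) _.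
case: gW => sW gW; have := TX W sW W1.
rewrite evK_evS !evS_hom_space ltrBlDr addrAC ltrBrDr -!natrD ltr_nat => ltW.
(* [K] consists of the maps from P_0 to [X] that induce a map from P_f1 to [X/W]. Positivity of
   [th1] on [X/W] makes [K] too large to lie in Hom(P_0, W). *)
pose K := (D (P0 th1) 1%:M :&: kermx (precomp X f1 *m cokermx (D (P1 th1) W)))%MS.
have /row_subPn[i0 nzW] : ~~ (K <= D (P0 th1) W)%MS.
  apply/negP=> /mxrankS.
  have := mxrank_mul_ker (D (P0 th1) 1%:M) (precomp X f1 *m cokermx (D (P1 th1) W)).
  have := mxrank_mul_ker (D (P1 th1) 1%:M) (cokermx (D (P1 th1) W)).
  have := mxrankS (submxMr (cokermx (D (P1 th1) W))
    (hom_space_precomp eK wf1 (@stable1 _ _ X))); rewrite -mulmxA.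
  have /mxrankS : (D (P1 th1) W <= D (P1 th1) 1%:M :&: kermx (cokermx (D (P1 th1) W)))%MS.
    by rewrite sub_capmx hom_space_mono ?submx1 //; apply/sub_kermxP/mulmx_coker.
  move=> leW le_im eq1 eq0 leK; move: ltW; rewrite -eq1 -eq0 ltnNge => /negP; apply.
  by rewrite [leqRHS]addnCA -addnA !leq_add.
set z := row i0 K in nzW.
have : (z <= K)%MS by apply: row_sub.
rewrite sub_capmx => /andP[zD zK].
have {zK} zf : (z *m precomp X f1 <= D (P1 th1) W)%MS.
  by rewrite submxE -mulmxA; apply/eqP/sub_kermxP.
have [||W' W'P] := @rowspace_pred k d (fun w => exists (w0 : 'rV_d) (x : 'I_(size (P0 th1)) -> A),
    (w0 <= W)%MS /\ w = w0 + \sum_a submxrow z a *m fact X (x a)).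
- exists 0, (fun=> 0); split; first by rewrite sub0mx.
  by rewrite add0r big1 // => a _; rewrite fmod_act0 mulmx0.
- move=> c _ _ [u [x [uW ->]]] [v [y [vW ->]]]; exists (c *: u + v), (fun a => c *: x a + y a).
  split; first by rewrite addmx_sub ?scalemx_sub.
  rewrite scalerDr addrACA; congr (_ + _); rewrite scaler_sumr -big_split /=.
  by apply: eq_bigr => a _; rewrite fact_lin mulmxDr -scalemxAr.
have WW' : (W <= W')%MS.
  apply/rV_subP => w wW; apply/W'P; exists w, (fun=> 0); split=> //.
  by rewrite big1 ?addr0 // => a _; rewrite fmod_act0 mulmx0.
have zW' : (z <= D (P0 th1) W')%MS.
  apply/hom_spaceP => a; rewrite -(hom_space_idem eK a zD); apply: submxMr; apply/W'P.
  exists 0, (fun b => if b == a then 1 else 0); split; first by rewrite sub0mx.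
  rewrite add0r (bigD1 a) //= eqxx fact_one mulmx1 big1 ?addr0 // => b ba.
  by rewrite (negbTE ba) fmod_act0 mulmx0.
have sW' : stable (X := X) W'.
  move=> y; apply/row_subP => i; rewrite row_mul; apply/W'P.
  have /W'P[w [x [wW ->]]] := row_sub i W'; exists (w *m fact X y), (fun a => x a * y).
  split; first by apply: submx_trans (submxMr _ wW) (sW y).
  rewrite mulmxDl mulmx_suml; congr (_ + _).
  by apply: eq_bigr => a _; rewrite fact_mul mulmxA.
exists W'.
  rewrite ltnNge (geq_leqif (mxrank_leqif_sup WW')); apply/negP => W'W.
  by move/negP: nzW; apply; apply: submx_trans zW' (hom_space_mono _ _ W'W).
split=> //; apply/rV_subP => y yW'.
(* Splitting each component of [y] into a part in [W] and a part generated by [z] writes [y] as a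
   map into [W] plus [z] composed with a morphism [h]. *)
have /choice[wx wxP] (b : 'I_(size (P1 th2))) :
    exists p : 'rV[k]_d * ('I_(size (P0 th1)) -> A), (p.1 <= W)%MS /\
      submxrow y b = (p.1 + \sum_a submxrow z a *m fact X (p.2 a)) *m fact X (e (oidx b)).
  have /hom_spaceP/(_ b)/submxP[c ->] := yW'.
  have /W'P[w [x [wW eqc]]] := submxMl c W'.
  by exists (w, x); rewrite /= -eqc mulmxA.
pose h : 'M[A]_(size (P0 th1), size (P1 th2)) :=
  \matrix_(a, b) (e (oidx a) * (wx b).2 a * e (oidx b)).
have wh : wf e h by move=> a b; rewrite !mxE !mulrA eK -!mulrA eK.
have -> : y = \mxrow_b ((wx b).1 *m fact X (e (oidx b))) + z *m precomp X h.
  rewrite -[z]submxrowK mul_mxrow_mxblock -mxrowD -[LHS]submxrowK; apply: eq_mxrow => b.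
  rewrite (wxP b).2 mulmxDl mulmx_suml; congr (_ + _); apply: eq_bigr => a _.
  by rewrite mxE !fact_mul !mulmxA (hom_space_idem eK a zD).
have gWW' : (D (P1 th2) W <= D (P0 th2) W' *m precomp X f2)%MS.
  by apply: submx_trans gW _; rewrite submxMr ?hom_space_mono.
rewrite addmx_sub //.
  apply: submx_trans gWW'; apply/hom_spaceP => b; rewrite mxrowK.
  by rewrite submxMr ?(wxP b).1.
(* Here [h = f1 u + v f2]: [z f1 u] lands in [W], which is already good, and [z v f2] is visibly in
   the image of [f2] from Hom(P_0, W'). *)
have [u [v [wu wv ->]]] := null h wh.
rewrite precompD !precomp_mul mulmxDr !mulmxA addmx_sub //.
  apply: submx_trans gWW'.
  exact: submx_trans (submxMr _ zf) (hom_space_precomp eK wu sW).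
apply: submxMr.
exact: submx_trans (submxMr _ zW') (hom_space_precomp eK wv sW').
Qed.

End Orthogonality.

(** * Torsion pairs *)

Section TorsionPairs.
Variables (k : closedFieldType) (A : falgType k).
Implicit Types (X Y Z : fmod A) (C : mclass A).

(** Factor out a submodule in [C] of largest dimension: the preimage of a nonzero submodule of [Z]
    in [C] would be a larger one, by closure under extensions. *)
Lemma torsion_quotient C X : torsion_class C ->
  exists Z, [/\ factor_of X Z, forall Y, submod_of Z Y -> C Y -> fdim Y = 0%N
    & fdim Z = 0%N -> C X].
Proof.
move=> [C0 [Cfac Cext]].
pose inC (W : 'M[k]_(fdim X)) := exists Y (M : 'M[k]_(fdim Y, fdim X)),
  [/\ mhom M, row_free M, (M :=: W)%MS & C Y].
have [||r [W [sW [Y [M [hM fM MW CY]]] rW]] Wmax] :=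
  @ex_max_nat (fun r => exists W, [/\ stable (X := X) W, inC W & \rank W = r]) (fdim X).
- exists 0%N, 0; split; [exact: stable0 | | exact: mxrank0].
  have [Y [M [hM fM M0]]] := sub_fmod (@stable0 _ _ X).
  by exists Y, M; split=> //; apply: C0; rewrite -(eqP fM) M0 mxrank0.
- by move=> _ [W [_ _ <-]]; apply: rank_leq_row.
have [Z [P [hP fP kP]]] := quo_fmod sW; exists Z; split; first by exists P.
  move=> Y' [N [hN fN]] CY'.
  have sN : stable (X := Z) N.
    by move=> a; rewrite -hN submxMl.
  have [W' [sW' W'P kW']] := preim_stable hP fP sN.
  have [Y2 [M2 [hM2 fM2 M2W']]] := sub_fmod sW'.
  have WW' : (W <= W')%MS by rewrite -kP.
  have capW : (W' :&: kermx P :=: W)%MS by apply: eqmx_trans kP; apply/capmx_idPr.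
  have rW' : \rank W' = (fdim Y' + \rank W)%N.
    by rewrite -(mxrank_mul_ker W' P) W'P capW (eqP fN).
  have M2P : (M2 *m P :=: N)%MS := eqmx_trans (eqmxMr P M2W') W'P.
  have eqf : M *m pinvmx M2 *m M2 = M by rewrite mulmxKpV // M2W' MW.
  have eqg : M2 *m P *m pinvmx N *m N = M2 *m P by rewrite mulmxKpV // M2P.
  have CY2 : C Y2.
    apply: (Cext Y Y2 Y') => //; exists (M *m pinvmx M2), (M2 *m P *m pinvmx N).
    split; first by apply: (mhom_cancel_free hM2 fM2); rewrite eqf.
    split; first by apply: (mhom_cancel_free hN fN); rewrite eqg; apply: mhom_mul.
    split; first by rewrite /row_free -(mxrankMfree _ fM2) eqf.
    split; first by rewrite /row_full -(mxrankMfree _ fN) eqg M2P (eqP fN).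
    split; last by rewrite -(eqP fM2) M2W' rW' -MW (eqP fM) addnC.
    apply: (row_free_inj fN).
    rewrite /= mul0mx -(mulmxA _ _ N) eqg mulmxA eqf; apply/sub_kermxP.
    by rewrite kP MW.
  have := Wmax _ (ex_intro _ W' (And3 sW' _ erefl)); rewrite rW' -rW.
  rewrite -[leqRHS]add0n leq_add2r leqn0 => H; apply/eqP/H.
  by exists Y2, M2.
move=> Z0; apply: Cfac CY _; exists M; split=> //.
rewrite /row_full MW -kP mxrank_ker (eqP fP) Z0 subn0 //.
Qed.

(** Take the smallest [W] with [X/W] in [C]. If the factor of [W] by a submodule [K] is in [C], then
    [X/K] is an extension of members of [C], so minimality forces [K = W]. *)
Lemma torsionfree_submod C X : torsionfree_class C ->
  exists Z, [/\ submod_of X Z, forall Y, factor_of Z Y -> C Y -> fdim Y = 0%N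
    & fdim Z = 0%N -> C X].
Proof.
move=> [C0 [Csub Cext]].
pose inC (W : 'M[k]_(fdim X)) := exists Z (P : 'M[k]_(fdim X, fdim Z)),
  [/\ mhom P, row_full P, (kermx P :=: W)%MS & C Z].
have [||r [W [sW [Z [P [hP fP kP CZ]]] rW]] Wmax] :=
  @ex_max_nat (fun r => exists W,
    [/\ stable (X := X) W, inC W & (fdim X - \rank W = r)%N]) (fdim X).
- exists 0%N, 1%:M; split; [exact: stable1 | | by rewrite mxrank1 subnn].
  have [Z [P [hP fP kP]]] := quo_fmod (@stable1 _ _ X).
  exists Z, P; split=> //; apply: C0; rewrite -(eqP fP); apply/eqP.
  by rewrite mxrank_eq0 -[P]mul1mx; apply/eqP/sub_kermxP; rewrite kP.
- by move=> _ [W [_ _ <-]]; apply: leq_subr.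
have [Z0 [M [hM fM MW]]] := sub_fmod sW; exists Z0; split; first by exists M.
  move=> Y [N [hN fN]] CY.
  have sW' : stable (X := X) (kermx N *m M) by apply: mhom_stable (ker_stable hN).
  have [Z2 [P2 [hP2 fP2 kP2]]] := quo_fmod sW'.
  have eqf : N *m (pinvmx N *m (M *m P2)) = M *m P2.
    by apply: full_factor; rewrite mulmxA; apply/sub_kermxP; rewrite kP2.
  have kP2P : (kermx P2 <= kermx P)%MS by rewrite kP2 kP -MW submxMl.
  have eqg : P2 *m (pinvmx P2 *m P) = P.
    by apply: full_factor; apply/sub_kermxP.
  have rkN : (\rank (kermx N *m M) + fdim Y = fdim Z0)%N.
    by rewrite mxrankMfree // mxrank_ker (eqP fN) subnK // -(eqP fN) rank_leq_row.
  have rMP2 : \rank (M *m P2) = fdim Y.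
    apply/eqP; rewrite -(eqn_add2l (\rank (kermx N *m M))) rkN -[in X in _ == X](eqP fM).
    rewrite -(mxrank_mul_ker M P2) addnC eqn_add2l; apply/eqP/eqmx_rank/eqmxP.
    apply: eqmx_trans (eqmx_sym kP2) (eqmx_sym _); apply/capmx_idPr.
    by rewrite kP2 submxMl.
  have dimZ : (fdim Z + fdim Z0 = fdim X)%N.
    rewrite -(eqP fM) MW -kP mxrank_ker (eqP fP) subnKC // -(eqP fP) rank_leq_row.
    by [].
  have dimZ2 : (fdim Z2 + \rank (kermx N *m M) = fdim X)%N.
    by rewrite -kP2 mxrank_ker (eqP fP2) subnKC // -(eqP fP2) rank_leq_row.
  have eqd : fdim Z2 = (fdim Y + fdim Z)%N.
    move: rkN dimZ dimZ2; move: (\rank (kermx N *m M)) => q rkN dimZ dimZ2.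
    apply/eqP; rewrite -(eqn_add2r q) dimZ2 -dimZ -rkN.
    by rewrite addnCA [eqbRHS]addnC [in eqbRHS](addnC (fdim Y)).
  have CZ2 : C Z2.
    apply: (Cext Y Z2 Z) => //; exists (pinvmx N *m (M *m P2)), (pinvmx P2 *m P).
    split; first by apply: (mhom_cancel_full hN fN); rewrite eqf; apply: mhom_mul.
    split; first by apply: (mhom_cancel_full hP2 fP2); rewrite eqg.
    split; first by rewrite /row_free -(eqmxMfull _ fN) eqf rMP2.
    split; first by rewrite /row_full -(eqmxMfull _ fP2) eqg.
    split=> //; apply: (row_full_inj fN).
    rewrite /= mulmx0 (mulmxA N) eqf -(mulmxA M) eqg; apply/sub_kermxP.
    by rewrite kP MW.
  have sgW' : stable (X := X) <<kermx N *m M>>%MS.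
    exact: (stable_eqmx (eqmx_sym (genmxE _)) sW').
  have := Wmax _ (ex_intro _ _ (And3 sgW' _ erefl)).
  have -> : r = fdim Z by rewrite -rW -MW (eqP fM) -dimZ addnK.
  rewrite mxrank_gen -[X in (X - _)%N]dimZ2 addnK eqd.
  rewrite -[leqRHS]add0n leq_add2r leqn0 => H; apply/eqP/H.
  by exists Z2, P2; split=> //; apply: eqmx_trans kP2 (eqmx_sym (genmxE _)).
move=> Z00; apply: Csub CZ _; exists P; split=> //.
by rewrite -kermx_eq0 -mxrank_eq0 kP -MW (eqP fM) Z00.
Qed.

End TorsionPairs.

(** * Strictly semistable classes are torsion and torsion-free classes *)

Section SemistableTorsion.
Variables (k : closedFieldType) (A : falgType k) (n : nat) (e : 'I_n -> A).
Hypothesis eK : forall i, e i * e i = e i.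
Variable R : realType.
Implicit Types (X Y Z : fmod A) (th : 'I_n -> R).

Lemma factor_of_refl X : factor_of X X.
Proof.
exists 1%:M; split; first by move=> a; rewrite mulmx1 mul1mx.
by rewrite /row_full mxrank1.
Qed.

Lemma submod_of_refl X : submod_of X X.
Proof.
exists 1%:M; split; first by move=> a; rewrite mulmx1 mul1mx.
by rewrite /row_free mxrank1.
Qed.

(** [V2] is the image of [V] in [Z], and [V1] is the part of [V] in the kernel, pulled back along
    the inclusion of [X]. *)
Lemma ses_stable X Y Z (V : 'M[k]_(fdim Y)) : ses X Y Z -> stable V ->
  exists (V1 : 'M[k]_(fdim X)) (V2 : 'M[k]_(fdim Z)), [/\ stable V1, stable V2,
    forall th, evS e th V = evS e th V1 + evS e th V2
    & \rank V = (\rank V1 + \rank V2)%N].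
Proof.
move=> [f [g [hf [hg [ff [fg [fg0 eqd]]]]]]] sV.
have kg : (kermx g :=: f)%MS.
  apply/eqmx_sym/eqmxP; have sfk : (f <= kermx g)%MS by apply/sub_kermxP.
  rewrite sfk /= -(geq_leqif (mxrank_leqif_sup sfk)) mxrank_ker (eqP fg) (eqP ff).
  by rewrite [X in (X - _)%N]eqd addnK.
pose U := (V :&: kermx g)%MS *m pinvmx f.
have Uf : U *m f = (V :&: kermx g)%MS.
  by rewrite mulmxKpV // (submx_trans (capmxSr _ _)) // kg.
have sU : stable (X := X) U.
  move=> a; rewrite -(submxMfree _ _ ff) -mulmxA hf mulmxA Uf.
  exact: (cap_stable sV (ker_stable hg)).
exists <<U>>%MS, <<V *m g>>%MS; split.
- exact: (stable_eqmx (eqmx_sym (genmxE _)) sU).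
- apply: (stable_eqmx (X := Z) (eqmx_sym (genmxE _))); exact: mhom_stable.
- move=> th; rewrite (evS_mul_ker eK _ hg sV) -Uf (evS_mul_free _ _ _ hf ff).
  by rewrite !(eqmx_evS _ _ (genmxE _)) addrC.
- by rewrite !mxrank_gen -(mxrank_mul_ker V g) -Uf (mxrankMfree _ ff) addnC.
Qed.

Lemma torsion_Tss th : torsion_class (Tss e th).
Proof.
split=> [X X0|]; first apply/(Tss_stable eK) => V _; first by rewrite [X in (_ < X)%N]X0 ltn0.
split=> [X Y TX XY Z YZ|X Y Z sXYZ /(Tss_stable eK) TX /(Tss_stable eK) TZ].
  exact: TX (factor_of_trans XY YZ).
apply/(Tss_stable eK) => V sV rV.
have eqd : fdim Y = (fdim X + fdim Z)%N by case: sXYZ => f [g [_ [_ [_ [_ []]]]]].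
have [V1 [V2 [sV1 sV2 evV rkV]]] := ses_stable sXYZ sV.
(* Applied to all of [Y], the splitting gives additivity of [th] on the sequence; the rank count
   forces both parts to be full. *)
have [W1 [W2 [_ _ evW rkW]]] := ses_stable sXYZ (@stable1 _ _ Y).
have [rW1 rW2] : \rank W1 = fdim X /\ \rank W2 = fdim Z.
  have := rank_leq_row W1; have := rank_leq_row W2; move: rkW; rewrite mxrank1 eqd.
  move: (\rank W1) (\rank W2) => r1 r2 eq le2 le1.
  have e1 : r1 = fdim X.
    apply/eqP; rewrite eqn_leq le1 /= leqNgt; apply/negP => lt1.
    by have := leq_add lt1 le2; rewrite addSn -eq ltnn.
  by split=> //; apply: (@addnI (fdim X)); rewrite -{1}e1.
rewrite evK_evS evW evV (evS_full _ _ rW1) (evS_full _ _ rW2).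
move: rV; rewrite rkV eqd => rV.
have le1 := rank_leq_row V1; have le2 := rank_leq_row V2.
move: le1; rewrite leq_eqVlt => /predU1P[eq1|lt1].
  by rewrite evS_full // ltrD2l TZ //; move: rV; rewrite eq1 ltn_add2l.
move: le2; rewrite leq_eqVlt => /predU1P[eq2|lt2].
  by rewrite [evS _ _ V2]evS_full // ltrD2r TX.
by rewrite ltrD ?TX ?TZ.
Qed.

Lemma torsionfree_Fss th : torsionfree_class (Fss e th).
Proof.
split=> [X X0|]; first apply/Fss_stable => V _.
  by rewrite ltnNge (leq_trans (rank_leq_row V)) // X0.
split=> [X Y FX XY Z YZ|X Y Z sXYZ /Fss_stable FX /Fss_stable FZ].
  exact: FX (submod_of_trans XY YZ).
apply/Fss_stable => V sV.
have [V1 [V2 [sV1 sV2 -> ->]]] := ses_stable sXYZ sV.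
have [r1|r1] := posnP (\rank V1).
  by rewrite r1 add0n (evS0 _ _ r1) add0r; apply: FZ.
have [r2|r2] := posnP (\rank V2).
  by rewrite (evS0 _ _ r2) addr0 => _; apply: FX.
by move=> _; rewrite -[ltRHS]addr0 ltrD ?FX ?FZ.
Qed.

End SemistableTorsion.

(** * Semistable classes along the open cone of the summands *)

Theorem theorem3p14 (k : closedFieldType) (A : falgType k) (n : nat)
  (e : 'I_n -> A) (He : complete_prim_idems e)
  (R : realType) (l : nat) (th : 'I_l -> 'I_n -> int) (theta : 'I_n -> int)
  (Hsum : forall j, theta j = \sum_(i < l) th i j)
  (Hdec : dsum_decomp e th) :
  (forall eta : 'I_n -> R, in_open_cone th eta ->
     eqclass (Tbar e eta) (bigcap (fun i => Tbar e (toR R (th i)))) /\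
     eqclass (Tss e eta) (tjoin (fun i => Tss e (toR R (th i)))) /\
     eqclass (Fbar e eta) (bigcap (fun i => Fbar e (toR R (th i)))) /\
     eqclass (Fss e eta) (fjoin (fun i => Fss e (toR R (th i)))) /\
     eqclass (Wss e eta) (bigcap (fun i => Wss e (toR R (th i))))) /\
  (forall eta : 'I_n -> R, in_open_cone th eta -> TF_equiv e (toR R theta) eta).
Proof.
have eK i : e i * e i = e i by case: (He.1 i).
have [fs [wfs null]] := general_null_shift eK Hdec.
have evK_cone (eta : 'I_n -> R) c X : (forall j, eta j = \sum_(i < l) c i * (th i j)%:~R) ->
    evK e eta X = \sum_(i < l) c i * evK e (toR R (th i)) X.
  move=> eta_c; under [RHS]eq_bigr do rewrite mulr_sumr.
  rewrite exchange_big; apply: eq_bigr => j _ /=; rewrite eta_c mulr_suml.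
  by apply: eq_bigr => i _; rewrite mulrA.
(* The [i]-th term is strictly negative and, by orthogonality, the others are at most zero. *)
have Fneg (eta : 'I_n -> R) i X : in_open_cone th eta -> (0 < fdim X)%N ->
    Fss e (toR R (th i)) X -> evK e eta X < 0.
  move=> [c [c0 /evK_cone ->]] X0 FX; rewrite (bigD1 i) //=.
  rewrite -[ltRHS]addr0 ltr_leD ?pmulr_rlt0 //.
    exact: FX (submod_of_refl X) X0.
  apply: sumr_le0 => j ji; rewrite pmulr_rle0 //.
  apply: (Fss_evK_le0 eK (wfs j) _ FX); apply: null; by rewrite eq_sym.
have Tpos (eta : 'I_n -> R) i X : in_open_cone th eta -> (0 < fdim X)%N ->
    Tss e (toR R (th i)) X -> 0 < evK e eta X.
  move=> [c [c0 /evK_cone ->]] X0 TX; rewrite (bigD1 i) //=.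
  rewrite ltr_wpDr ?pmulr_rgt0 //; last exact: TX (factor_of_refl X) X0.
  apply: sumr_ge0 => j ji; rewrite pmulr_rge0 //.
  by apply: (Tss_evK_ge0 eK (wfs i) (wfs j) _ TX); apply: null.
have TbarP (eta : 'I_n -> R) : in_open_cone th eta ->
    eqclass (Tbar e eta) (bigcap (fun i => Tbar e (toR R (th i)))).
  move=> Heta X; split=> [TX i|TX Y XY].
    apply: contrapT => /(not_Tbar eK)[Z [XZ FZ Z0]].
    by have := TX Z XZ; rewrite leNgt (Fneg _ _ _ Heta Z0 FZ).
  have [c [c0 /evK_cone ->]] := Heta.
  by apply: sumr_ge0 => i _; rewrite pmulr_rge0 // TX.
have FbarP (eta : 'I_n -> R) : in_open_cone th eta ->
    eqclass (Fbar e eta) (bigcap (fun i => Fbar e (toR R (th i)))).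
  move=> Heta X; split=> [FX i|FX Y XY].
    apply: contrapT => /(not_Fbar eK)[Z [XZ TZ Z0]].
    by have := FX Z XZ; rewrite leNgt (Tpos _ _ _ Heta Z0 TZ).
  have [c [c0 /evK_cone ->]] := Heta.
  by apply: sumr_le0 => i _; rewrite pmulr_rle0 // FX.
split=> eta Heta.
  split; first exact: TbarP.
  split.
    (* The [C]-free quotient [Z] of [X] has no nonzero submodule in any [Tss] of a summand, so it
       lies in every [Fbar], hence in [Fbar e eta]. As a factor of [X] it must then be zero. *)
    move=> X; split=> [TX C Ctors Csup | TX].
      have [Z [XZ ZC Z0]] := torsion_quotient X Ctors; apply: Z0.
      have FZ : Fbar e eta Z.
        apply/FbarP => // i; apply: contrapT => /(not_Fbar eK)[Y [ZY TY]].
        by rewrite (ZC Y ZY (Csup i Y TY)).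
      apply/eqP; rewrite -leqn0 leqNgt; apply/negP => Z0.
      by have := TX Z XZ Z0; rewrite ltNge (FZ Z (submod_of_refl Z)).
    (* Conversely [Tss e eta] is itself a torsion class containing each [Tss] of a summand. *)
    apply: TX (torsion_Tss eK eta) _ => i Y TY Z YZ Z0; apply: (Tpos _ i) => //.
    by move=> Z' ZZ'; apply: TY; apply: factor_of_trans ZZ'.
  split; first exact: FbarP.
  split.
    move=> X; split=> [FX C Ctors Csup | FX].
      have [Z [XZ ZC Z0]] := torsionfree_submod X Ctors; apply: Z0.
      have TZ : Tbar e eta Z.
        apply/TbarP => // i; apply: contrapT => /(not_Tbar eK)[Y [ZY FY]].
        by rewrite (ZC Y ZY (Csup i Y FY)).
      apply/eqP; rewrite -leqn0 leqNgt; apply/negP => Z0.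
      by have := FX Z XZ Z0; rewrite ltNge (TZ Z (factor_of_refl Z)).
    apply: FX (torsionfree_Fss eK eta) _ => i Y FY Z YZ Z0; apply: (Fneg _ i) => //.
    by move=> Z' ZZ'; apply: FY; apply: submod_of_trans ZZ'.
  move=> X; split=> [[/TbarP TX /FbarP FX] i | WX].
    by split; [apply: TX | apply: FX].
  by split; [apply/TbarP | apply/FbarP] => // i; case: (WX i).
(* With all coefficients 1, [theta] lies in the cone, so its classes and those of [eta] are the same
   intersections. *)
have Htheta : in_open_cone th (toR R theta).
  exists (fun=> 1); split=> [i|j]; first exact: ltr01.
  by rewrite /toR Hsum rmorph_sum; apply: eq_bigr => i _; rewrite mul1r.
split=> X.
  by split=> [/TbarP TX|/TbarP TX]; apply/TbarP => //; apply: TX.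
by split=> [/FbarP FX|/FbarP FX]; apply/FbarP => //; apply: FX.
Qed.
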